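(* Let $f=f(x^1,x^3)$ be smooth with $f_3\neq0$. The conformal classes $[g_{\mathcal D_f}]$ defined by the metrics $g_{\mathcal D_f}=2\theta^1\theta^4+2\theta^2\theta^5+2\theta^3\theta^6$ have the following properties: (i) Generically (i.e. for generic $f$) they are not conformally Cotton-flat, and hence not conformally Einstein. (ii) They are Bach-flat and their Schouten tensor squares to zero, $P_i{}^kP_{kj}=0$. In particular, the tensor $\mu_{ij}=\frac1{4-n}B_{ij}+P_i{}^kP_{kj}$ (with $n=6$) vanishes. (iii) Each term in the formula $$\begin{aligned}\mathcal O_{ij}=&\nabla^k\nabla_kB_{ij}-2W_{kijl}B^{kl}-4P_k{}^kB_{ij}+8P^{kl}\nabla_lC_{(ij)k}-4C^{k}{}_i{}^{l}C_{ljk}\\&+2C_i{}^{kl}C_{jkl}+4C_{ij}{}^l\nabla_lP^k{}_k-4W_{kijl}P^k{}_mP^{ml}\end{aligned}$$ for the Fefferman-Graham obstruction tensor $\mathcal O$ vanishes separately. Hence $\mathcal O\equiv0$. (iv) An ambient metric for all such conformal classes is given by $$\tilde g_f=2\,d(\varrho t)\,dt+t^2\big(g_{\mathcal D_f}+2\varrho P\big).$$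
   Context: Coordinates on an open set $\mathcal U\subset\mathbb R^6$ near the origin are $(x^1,x^2,x^3,y^1,y^2,y^3)$; $f_i=\partial f/\partial x^i$ etc. For $f=f(x^1,x^3)$ the co-frame is $\theta^1=dy^1+x^2dx^3$, $\theta^2=dy^2+f\,dx^1$, $\theta^3=dy^3+x^1dx^2$, $\theta^4=\tfrac32f_3^2dx^1$, $\theta^5=\tfrac32f_3dx^2-\tfrac12f_{33}\theta^1$, $\theta^6=\tfrac32f_3^2dx^3+\tfrac12f_{13}\theta^2$. (This represents Bryant's conformal class of the generic rank 3 distribution annihilated by $\theta^1,\theta^2,\theta^3$.) For $g_{\mathcal D_f}$ in dimension $n=6$: $\nabla$ is the Levi-Civita connection, $P=\frac1{n-2}\big(Ric-\frac{Scal}{2(n-1)}g\big)$ the Schouten tensor, $W_{ijkl}$ the Weyl tensor, $C_{ijk}=\nabla_kP_{ij}-\nabla_jP_{ik}$ the Cotton tensor, $B_{ij}=\nabla^kC_{ijk}-P^{kl}W_{kijl}$ the Bach tensor. A metric is conformally Cotton-flat (conformally Einstein) if it is locally conformal to a metric with vanishing Cotton tensor (to an Einstein metric). An ambient metric for $g_0$ is a Ricci-flat metric $2\,dt\,d(\varrho t)+t^2g(x^i,\varrho)$ with $t>0$ and $g(x^i,0)=g_0$. *)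

(* Defs.v *)
From HB Require Import structures.
From mathcomp Require Import all_boot all_order all_algebra.
From mathcomp Require Import all_classical all_reals all_analysis.

Set Implicit Arguments.
Unset Strict Implicit.
Unset Printing Implicit Defensive.

Import Order.TTheory GRing.Theory Num.Theory.
Import numFieldNormedType.Exports.

Local Open Scope classical_set_scope.
Local Open Scope ring_scope.

(** * Partial derivatives and smooth functions on subsets of R^n *)

Definition partial {R : realType} {n : nat} (i : 'I_n) (F : 'rV[R]_n -> R) :
    'rV[R]_n -> R :=
  fun p => 'D_(delta_mx 0 i) F p.

Definition partials {R : realType} {n : nat} (s : seq 'I_n)
    (F : 'rV[R]_n -> R) : 'rV[R]_n -> R :=
  foldr partial F s.

(* For open D this is C^infty on D: differentiability of an iterated partial
   derivative gives its continuity and the existence of the next ones. *)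
Definition smooth_on {R : realType} {n : nat} (D : set 'rV[R]_n)
    (F : 'rV[R]_n -> R) : Prop :=
  forall (s : seq 'I_n) (p : 'rV[R]_n), D p -> differentiable (partials s F) p.

(** * Pseudo-Riemannian geometry in local coordinates

    A field of bilinear forms is a matrix-valued function of the point;
    tensors of higher rank are functions of the point and of the indices,
    all indices being lowered unless stated otherwise. *)

Definition metric_on {R : realType} {n : nat} (D : set 'rV[R]_n)
    (g : 'rV[R]_n -> 'M[R]_n) : Prop :=
  [/\ forall i j, smooth_on D (fun p => g p i j),
      forall p, D p -> (g p)^T = g p
    & forall p, D p -> g p \in unitmx].

(* christoffel g p k i j = Gamma^k_{ij}, for the Levi-Civita connection *)
Definition christoffel {R : realType} {n : nat} (g : 'rV[R]_n -> 'M[R]_n)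
    (p : 'rV[R]_n) (k i j : 'I_n) : R :=
  2^-1 * \sum_l invmx (g p) k l *
    (partial i (fun q => g q j l) p + partial j (fun q => g q i l) p
     - partial l (fun q => g q i j) p).

(* riemann_up g p m j k l = R^m_{jkl}, where
   (nabla_k nabla_l - nabla_l nabla_k) X^m = R^m_{jkl} X^j. *)
Definition riemann_up {R : realType} {n : nat} (g : 'rV[R]_n -> 'M[R]_n)
    (p : 'rV[R]_n) (m j k l : 'I_n) : R :=
  partial k (fun q => christoffel g q m l j) p
  - partial l (fun q => christoffel g q m k j) p
  + \sum_a (christoffel g p m k a * christoffel g p a l j
            - christoffel g p m l a * christoffel g p a k j).

(* R_{ijkl}; it equals g_{ik} g_{jl} - g_{il} g_{jk} on the unit sphere. *)
Definition riemann {R : realType} {n : nat} (g : 'rV[R]_n -> 'M[R]_n)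
    (p : 'rV[R]_n) (i j k l : 'I_n) : R :=
  \sum_m g p i m * riemann_up g p m j k l.

Definition ricci {R : realType} {n : nat} (g : 'rV[R]_n -> 'M[R]_n)
    (p : 'rV[R]_n) : 'M[R]_n :=
  \matrix_(j, l) \sum_k riemann_up g p k j k l.

Definition scal {R : realType} {n : nat} (g : 'rV[R]_n -> 'M[R]_n)
    (p : 'rV[R]_n) : R :=
  \sum_i \sum_j invmx (g p) i j * ricci g p i j.

Definition schouten {R : realType} {n : nat} (g : 'rV[R]_n -> 'M[R]_n)
    (p : 'rV[R]_n) : 'M[R]_n :=
  (n%:R - 2)^-1 *: (ricci g p - (scal g p / (2 * (n%:R - 1))) *: g p).

Definition weyl {R : realType} {n : nat} (g : 'rV[R]_n -> 'M[R]_n)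
    (p : 'rV[R]_n) (i j k l : 'I_n) : R :=
  riemann g p i j k l
  - (g p i k * schouten g p j l + g p j l * schouten g p i k
     - g p i l * schouten g p j k - g p j k * schouten g p i l).

(* nabla2 g T p i j k = nabla_k T_{ij} *)
Definition nabla2 {R : realType} {n : nat} (g : 'rV[R]_n -> 'M[R]_n)
    (T : 'rV[R]_n -> 'M[R]_n) (p : 'rV[R]_n) (i j k : 'I_n) : R :=
  partial k (fun q => T q i j) p
  - \sum_m christoffel g p m k i * T p m j
  - \sum_m christoffel g p m k j * T p i m.

(* nabla3 g T p i j k l = nabla_l T_{ijk} *)
Definition nabla3 {R : realType} {n : nat} (g : 'rV[R]_n -> 'M[R]_n)
    (T : 'rV[R]_n -> 'I_n -> 'I_n -> 'I_n -> R)
    (p : 'rV[R]_n) (i j k l : 'I_n) : R :=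
  partial l (fun q => T q i j k) p
  - \sum_m christoffel g p m l i * T p m j k
  - \sum_m christoffel g p m l j * T p i m k
  - \sum_m christoffel g p m l k * T p i j m.

Definition cotton {R : realType} {n : nat} (g : 'rV[R]_n -> 'M[R]_n)
    (p : 'rV[R]_n) (i j k : 'I_n) : R :=
  nabla2 g (schouten g) p i j k - nabla2 g (schouten g) p i k j.

(* T^i_j *)
Definition raise1 {R : realType} {n : nat} (g : 'rV[R]_n -> 'M[R]_n)
    (T : 'rV[R]_n -> 'M[R]_n) (p : 'rV[R]_n) : 'M[R]_n :=
  invmx (g p) *m T p.

(* T^{ij} *)
Definition raise2 {R : realType} {n : nat} (g : 'rV[R]_n -> 'M[R]_n)
    (T : 'rV[R]_n -> 'M[R]_n) (p : 'rV[R]_n) : 'M[R]_n :=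
  invmx (g p) *m T p *m invmx (g p).

Definition bach {R : realType} {n : nat} (g : 'rV[R]_n -> 'M[R]_n)
    (p : 'rV[R]_n) : 'M[R]_n :=
  \matrix_(i, j)
    (\sum_k \sum_l invmx (g p) k l * nabla3 g (cotton g) p i j k l
     - \sum_k \sum_l raise2 g (schouten g) p k l * weyl g p k i j l).

(* P_i^k P_{kj} *)
Definition schouten_sq {R : realType} {n : nat} (g : 'rV[R]_n -> 'M[R]_n)
    (p : 'rV[R]_n) : 'M[R]_n :=
  schouten g p *m invmx (g p) *m schouten g p.

Definition mu_tensor {R : realType} {n : nat} (g : 'rV[R]_n -> 'M[R]_n)
    (p : 'rV[R]_n) : 'M[R]_n :=
  (4 - n%:R)^-1 *: bach g p + schouten_sq g p.

(** * The terms of the obstruction tensor, without numerical coefficients *)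

(* nabla^k nabla_k B_{ij} *)
Definition obs_lapl_bach {R : realType} {n : nat} (g : 'rV[R]_n -> 'M[R]_n)
    (p : 'rV[R]_n) : 'M[R]_n :=
  \matrix_(i, j) \sum_k \sum_l
    invmx (g p) k l * nabla3 g (nabla2 g (bach g)) p i j k l.

(* W_{kijl} B^{kl} *)
Definition obs_weyl_bach {R : realType} {n : nat} (g : 'rV[R]_n -> 'M[R]_n)
    (p : 'rV[R]_n) : 'M[R]_n :=
  \matrix_(i, j) \sum_k \sum_l weyl g p k i j l * raise2 g (bach g) p k l.

(* P_k^k *)
Definition schouten_tr {R : realType} {n : nat} (g : 'rV[R]_n -> 'M[R]_n)
    (p : 'rV[R]_n) : R :=
  \tr (raise1 g (schouten g) p).

(* P_k^k B_{ij} *)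
Definition obs_tr_bach {R : realType} {n : nat} (g : 'rV[R]_n -> 'M[R]_n)
    (p : 'rV[R]_n) : 'M[R]_n :=
  schouten_tr g p *: bach g p.

(* C_{(ij)k} *)
Definition cotton_sym {R : realType} {n : nat} (g : 'rV[R]_n -> 'M[R]_n)
    (p : 'rV[R]_n) (i j k : 'I_n) : R :=
  2^-1 * (cotton g p i j k + cotton g p j i k).

(* P^{kl} nabla_l C_{(ij)k} *)
Definition obs_schouten_dcotton {R : realType} {n : nat}
    (g : 'rV[R]_n -> 'M[R]_n) (p : 'rV[R]_n) : 'M[R]_n :=
  \matrix_(i, j) \sum_k \sum_l
    raise2 g (schouten g) p k l * nabla3 g (cotton_sym g) p i j k l.

(* C^k_i^l C_{ljk} *)
Definition obs_cotton_cotton1 {R : realType} {n : nat}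
    (g : 'rV[R]_n -> 'M[R]_n) (p : 'rV[R]_n) : 'M[R]_n :=
  \matrix_(i, j) \sum_k \sum_l
    (\sum_a \sum_b invmx (g p) k a * invmx (g p) l b * cotton g p a i b)
    * cotton g p l j k.

(* C_i^{kl} C_{jkl} *)
Definition obs_cotton_cotton2 {R : realType} {n : nat}
    (g : 'rV[R]_n -> 'M[R]_n) (p : 'rV[R]_n) : 'M[R]_n :=
  \matrix_(i, j) \sum_k \sum_l
    (\sum_a \sum_b invmx (g p) k a * invmx (g p) l b * cotton g p i a b)
    * cotton g p j k l.

(* C_{ij}^l nabla_l P^k_k *)
Definition obs_cotton_dtr {R : realType} {n : nat} (g : 'rV[R]_n -> 'M[R]_n)
    (p : 'rV[R]_n) : 'M[R]_n :=
  \matrix_(i, j) \sum_l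
    (\sum_a invmx (g p) l a * cotton g p i j a) * partial l (schouten_tr g) p.

(* W_{kijl} P^k_m P^{ml} *)
Definition obs_weyl_schouten_sq {R : realType} {n : nat}
    (g : 'rV[R]_n -> 'M[R]_n) (p : 'rV[R]_n) : 'M[R]_n :=
  \matrix_(i, j) \sum_k \sum_l
    weyl g p k i j l *
    \sum_m raise1 g (schouten g) p k m * raise2 g (schouten g) p m l.

(* The Fefferman-Graham obstruction tensor in dimension 6 *)
Definition obstruction {R : realType} (g : 'rV[R]_6 -> 'M[R]_6)
    (p : 'rV[R]_6) : 'M[R]_6 :=
  obs_lapl_bach g p - 2 *: obs_weyl_bach g p - 4 *: obs_tr_bach g p
  + 8 *: obs_schouten_dcotton g p - 4 *: obs_cotton_cotton1 g p
  + 2 *: obs_cotton_cotton2 g p + 4 *: obs_cotton_dtr g p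
  - 4 *: obs_weyl_schouten_sq g p.

(** * Conformal rescalings *)

Definition conf_rescale {R : realType} {n : nat} (phi : 'rV[R]_n -> R)
    (g : 'rV[R]_n -> 'M[R]_n) : 'rV[R]_n -> 'M[R]_n :=
  fun p => expR (2 * phi p) *: g p.

Definition cotton_flat_on {R : realType} {n : nat} (D : set 'rV[R]_n)
    (g : 'rV[R]_n -> 'M[R]_n) : Prop :=
  forall p, D p -> forall i j k, cotton g p i j k = 0.

Definition einstein_on {R : realType} {n : nat} (D : set 'rV[R]_n)
    (g : 'rV[R]_n -> 'M[R]_n) : Prop :=
  exists lam : R, forall p, D p -> ricci g p = lam *: g p.

Definition locally_conformal_to {R : realType} {n : nat}
    (Q : set 'rV[R]_n -> ('rV[R]_n -> 'M[R]_n) -> Prop)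
    (D : set 'rV[R]_n) (g : 'rV[R]_n -> 'M[R]_n) : Prop :=
  forall p, D p -> exists (V : set 'rV[R]_n) (phi : 'rV[R]_n -> R),
    [/\ open V, V p, V `<=` D, smooth_on V phi & Q V (conf_rescale phi g)].

Definition conformally_cotton_flat {R : realType} {n : nat}
    (D : set 'rV[R]_n) (g : 'rV[R]_n -> 'M[R]_n) : Prop :=
  locally_conformal_to cotton_flat_on D g.

Definition conformally_einstein {R : realType} {n : nat}
    (D : set 'rV[R]_n) (g : 'rV[R]_n -> 'M[R]_n) : Prop :=
  locally_conformal_to einstein_on D g.

(** * Symmetric products of one-forms and ambient metrics *)

(* The symmetric product is normalised by a b = (a (x) b + b (x) a) / 2. *)
Definition sprod {R : realType} {n : nat} (a b : 'rV[R]_n) : 'M[R]_n :=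
  2^-1 *: (a^T *m b + b^T *m a).

(* Points of the ambient space are the rows (t, x, rho). *)
Definition amb_t {R : realType} {n : nat} (q : 'rV[R]_(1 + n + 1)) : R :=
  lsubmx (lsubmx q) 0 0.
Definition amb_x {R : realType} {n : nat} (q : 'rV[R]_(1 + n + 1)) :
    'rV[R]_n :=
  rsubmx (lsubmx q).
Definition amb_rho {R : realType} {n : nat} (q : 'rV[R]_(1 + n + 1)) : R :=
  rsubmx q 0 0.

Definition amb_dt {R : realType} {n : nat} : 'rV[R]_(1 + n + 1) :=
  delta_mx 0 (lshift 1 (lshift n ord0)).
Definition amb_drho {R : realType} {n : nat} : 'rV[R]_(1 + n + 1) :=
  delta_mx 0 (rshift (1 + n) ord0).

(* d(rho t), expanded by the product rule *)
Definition amb_drhot {R : realType} {n : nat} (q : 'rV[R]_(1 + n + 1)) :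
    'rV[R]_(1 + n + 1) :=
  amb_rho q *: amb_dt + amb_t q *: amb_drho.

(* A bilinear form in the x-directions, pulled back to the ambient space *)
Definition amb_pull {R : realType} {n : nat} (h : 'M[R]_n) :
    'M[R]_(1 + n + 1) :=
  block_mx (block_mx 0 0 0 h) 0 0 0.

(* 2 dt d(rho t) + t^2 g(x, rho) *)
Definition amb_form {R : realType} {n : nat}
    (g : 'rV[R]_n -> R -> 'M[R]_n) (q : 'rV[R]_(1 + n + 1)) :
    'M[R]_(1 + n + 1) :=
  2 *: sprod (amb_drhot q) amb_dt
  + (amb_t q) ^+ 2 *: amb_pull (g (amb_x q) (amb_rho q)).

Definition amb_domain {R : realType} {n : nat} (D : set 'rV[R]_n) :
    set 'rV[R]_(1 + n + 1) :=
  [set q | 0 < amb_t q /\ D (amb_x q)].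

Definition ambient_metric {R : realType} {n : nat} (D : set 'rV[R]_n)
    (g0 : 'rV[R]_n -> 'M[R]_n) (g : 'rV[R]_n -> R -> 'M[R]_n) : Prop :=
  [/\ forall p, D p -> g p 0 = g0 p,
      metric_on (amb_domain D) (amb_form g)
    & forall q, amb_domain D q -> ricci (amb_form g) q = 0].

(** * The metrics g_{D_f}

    The coordinates (x^1, x^2, x^3, y^1, y^2, y^3) are numbered from 0 to 5;
    f is a function of the row (x^1, x^3). *)

Definition ix1 : 'I_6 := @Ordinal 6 0 isT.
Definition ix2 : 'I_6 := @Ordinal 6 1 isT.
Definition ix3 : 'I_6 := @Ordinal 6 2 isT.
Definition iy1 : 'I_6 := @Ordinal 6 3 isT.
Definition iy2 : 'I_6 := @Ordinal 6 4 isT.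
Definition iy3 : 'I_6 := @Ordinal 6 5 isT.

Definition pr13 {R : realType} (p : 'rV[R]_6) : 'rV[R]_2 :=
  \row_(j < 2) p 0 (if j == ord0 then ix1 else ix3).

(* f_1 and f_3 *)
Definition d1 {R : realType} (f : 'rV[R]_2 -> R) : 'rV[R]_2 -> R :=
  partial (@Ordinal 2 0 isT) f.
Definition d3 {R : realType} (f : 'rV[R]_2 -> R) : 'rV[R]_2 -> R :=
  partial (@Ordinal 2 1 isT) f.

Definition dc {R : realType} (i : 'I_6) : 'rV[R]_6 := delta_mx 0 i.

Definition theta1 {R : realType} (p : 'rV[R]_6) : 'rV[R]_6 :=
  dc iy1 + p 0 ix2 *: dc ix3.
Definition theta2 {R : realType} (f : 'rV[R]_2 -> R) (p : 'rV[R]_6) :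
    'rV[R]_6 :=
  dc iy2 + f (pr13 p) *: dc ix1.
Definition theta3 {R : realType} (p : 'rV[R]_6) : 'rV[R]_6 :=
  dc iy3 + p 0 ix1 *: dc ix2.
Definition theta4 {R : realType} (f : 'rV[R]_2 -> R) (p : 'rV[R]_6) :
    'rV[R]_6 :=
  (3 / 2 * d3 f (pr13 p) ^+ 2) *: dc ix1.
Definition theta5 {R : realType} (f : 'rV[R]_2 -> R) (p : 'rV[R]_6) :
    'rV[R]_6 :=
  (3 / 2 * d3 f (pr13 p)) *: dc ix2
  - (1 / 2 * d3 (d3 f) (pr13 p)) *: theta1 p.
Definition theta6 {R : realType} (f : 'rV[R]_2 -> R) (p : 'rV[R]_6) :
    'rV[R]_6 :=
  (3 / 2 * d3 f (pr13 p) ^+ 2) *: dc ix3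
  + (1 / 2 * d3 (d1 f) (pr13 p)) *: theta2 f p.

Definition gD {R : realType} (f : 'rV[R]_2 -> R) (p : 'rV[R]_6) : 'M[R]_6 :=
  2 *: sprod (theta1 p) (theta4 f p) + 2 *: sprod (theta2 f p) (theta5 f p)
  + 2 *: sprod (theta3 p) (theta6 f p).

Definition admissible {R : realType} (D : set 'rV[R]_2) (f : 'rV[R]_2 -> R) :
    Prop :=
  smooth_on D f /\ forall q, D q -> d3 f q != 0.

(** * Genericity

    The C^infty topology (uniform convergence on compact subsets of D of the
    partial derivatives of all orders) has the sets [Cinfty_near D f k K e] as
    basic neighbourhoods of f. *)

Definition Cinfty_near {R : realType} {n : nat} (f : 'rV[R]_n -> R) (k : nat)
    (K : set 'rV[R]_n) (e : R) (h : 'rV[R]_n -> R) : Prop :=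
  forall (s : seq 'I_n) (q : 'rV[R]_n), (size s <= k)%N -> K q ->
    `|partials s h q - partials s f q| < e.

(* Q holds on an open dense subset of A, for the C^infty topology over D *)
Definition generically {R : realType} {n : nat} (D : set 'rV[R]_n)
    (A Q : set ('rV[R]_n -> R)) : Prop :=
  exists G : set ('rV[R]_n -> R),
    [/\ G `<=` A `&` Q,
        forall f, G f -> exists k K e, [/\ compact K, K `<=` D, 0 < e
          & forall h, A h -> Cinfty_near f k K e h -> G h]
      & forall f k K e, A f -> compact K -> K `<=` D -> 0 < e ->
          exists2 h, G h & Cinfty_near f k K e h].

(* Main.v *)
(** Everything is computed in the coordinates (x^1, x^2, x^3, y^1, y^2, y^3).
    All the components of all the tensors are Laurent polynomials in the
    coordinates, the partial derivatives of f and the nonvanishing function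
    f_3, so that vanishing can be decided by computing with polynomials whose
    variables are formal derivatives; this settles (ii)-(iv), the ambient
    metric having the polynomial inverse g^-1 - 2 rho g^-1 P g^-1 in the
    x-directions because P^2 = 0.

    For (i), the Weyl tensor satisfies W_{l424} = 0 for all l (indices numbered
    from 0), hence the component C_{424} of the Cotton tensor is the same for
    all metrics e^{2 phi} g, and a conformally Cotton-flat g has C_{424} = 0.
    This is a condition on the 4-jet of f at a point, affine in f_1133 with
    slope proportional to 4 f_33^2 - 3 f_3 f_333.  Adding first a small multiple
    of sin^3 (f - c), then one of sin^2 (x^1 - a) sin^2 (f - c), makes the slope
    and then C_{424} nonzero.  Since these bumps have x^3-derivatives of the
    form f_3 times a bounded function, f_3 remains nonzero everywhere. *)

Require Import Defs.
From Stdlib Require Import ZArith.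
From mathcomp Require Import all_boot all_order all_algebra.
From mathcomp Require Import all_classical all_reals all_analysis.
From mathcomp Require Import ssrZ zify ring lra.

Set Implicit Arguments.
Unset Strict Implicit.
Unset Printing Implicit Defensive.

Import Order.TTheory GRing.Theory Num.Theory.
Import numFieldNormedType.Exports.

Local Open Scope classical_set_scope.
Local Open Scope ring_scope.

Delimit Scope Z_scope with BZ.

(** An environment gives the formal variables values at each point, and a model asserts that the
    partial derivatives of these values are again values of polynomials. The arithmetic is proved
    sound: an empty normal form forces the represented function to vanish. An iterated partial
    derivative must have a single name for terms to cancel, so derivatives are kept in a fixed
    order; this is where symmetry of second derivatives enters. Division occurs only by f_3 and by
    e^{2 phi} or t, whence two variables with integer exponents; inverse metrics are then written
    down and certified by one product. For (i), conformal flatness is required near every point of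
    U, so C_{424} nonzero at one fixed point refutes it, and the open dense set is cut out by a
    condition on the jet at that point. The obstacle is density: a neighbourhood in the C^infty
    topology controls functions on a compact set only, while f_3 must stay nonzero on the whole
    domain. Sines serve as bumps because sine and cosine are closed under differentiation, which
    keeps them inside the polynomial calculus; as they lack compact support, f_3 has to be
    controlled by the factorisation of their derivatives. *)

(** * Laurent polynomials with computable coefficients *)

(* [Crd i] is a coordinate, [Jet a b] the derivative d_1^a d_3^b f,
   [Pot s] an iterated derivative of the logarithm of the conformal factor;
   [Sin 0] and [Sin 1] are sin (x^1 - a) and sin (f - c). *)
Inductive atom : Type :=
  | Crd of nat | Jet of nat & nat | Pot of seq nat | Sin of nat | Cos of nat.

(** An injective code: the lexicographic order on lists of naturals then gives a computable total
    order on the variables. *)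
Definition atom_code (v : atom) : seq nat :=
  match v with
  | Crd i => [:: 0; i] | Jet a b => [:: 1; a; b] | Pot s => 2 :: s
  | Sin i => [:: 3; i] | Cos i => [:: 4; i]
  end%N.

Fixpoint seq_cmp (s t : seq nat) : comparison :=
  match s, t with
  | [::], [::] => Eq
  | [::], _ => Lt
  | _, [::] => Gt
  | a :: s', b :: t' =>
      match Nat.compare a b with Eq => seq_cmp s' t' | c => c end
  end.

Definition atom_cmp (v w : atom) := seq_cmp (atom_code v) (atom_code w).

Definition powers : Type := seq (atom * nat).

(* Only two of the variables, [u1] and [u2], may have negative exponents;
   these exponents come first. *)
Definition mono : Type := (Z * Z * powers)%type.

(** This is the lexicographic monomial order in which a smaller atom is the more significant
    variable, hence the reversal of [Lt] and [Gt]. It is compatible with multiplication, so [pterm]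
    may map over a sorted list without sorting again. Sortedness only governs cancellation;
    evaluation is additive on all lists. *)
Fixpoint powers_cmp (l k : powers) : comparison :=
  match l, k with
  | [::], [::] => Eq
  | [::], _ => Lt
  | _, [::] => Gt
  | (v, m) :: l', (w, n) :: k' =>
      match atom_cmp v w with
      | Eq => match Nat.compare m n with Eq => powers_cmp l' k' | c => c end
      | Lt => Gt
      | Gt => Lt
      end
  end.

Definition mono_cmp (m n : mono) : comparison :=
  let: (a, b, l) := m in let: (a', b', l') := n in
  match Z.compare a a' with
  | Eq => match Z.compare b b' with Eq => powers_cmp l l' | c => c end
  | c => c
  end.

Fixpoint powers_mul (l : powers) : powers -> powers :=
  fix aux (k : powers) :=
  match l, k with
  | [::], _ => k
  | _, [::] => l
  | (v, m) :: l', (w, n) :: k' =>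
      match atom_cmp v w with
      | Eq => (v, m + n)%N :: powers_mul l' k'
      | Lt => (v, m) :: powers_mul l' k
      | Gt => (w, n) :: aux k'
      end
  end.

Definition mono_mul (m n : mono) : mono :=
  let: (a, b, l) := m in let: (a', b', l') := n in
  (Z.add a a', Z.add b b', powers_mul l l').

(* The pair (z, e) stands for z / 30 ^ e; these fractions contain all the
   rational constants needed in dimension 6. *)
Definition coef : Type := (Z * nat)%type.

Fixpoint pow30 (n : nat) : Z :=
  if n is n'.+1 then Z.mul 30 (pow30 n') else 1%BZ.

Definition coef_add (c d : coef) : coef :=
  let: (a, e) := c in let: (b, f) := d in
  if (e <= f)%N then (Z.add (Z.mul a (pow30 (f - e))) b, f)
  else (Z.add a (Z.mul b (pow30 (e - f))), e).

Definition coef_mul (c d : coef) : coef := (Z.mul c.1 d.1, (c.2 + d.2)%N).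

Definition lpoly : Type := seq (coef * mono).

Fixpoint padd (p : lpoly) : lpoly -> lpoly :=
  fix aux (q : lpoly) :=
  match p, q with
  | [::], _ => q
  | _, [::] => p
  | (c, m) :: p', (d, n) :: q' =>
      match mono_cmp m n with
      | Eq => let s := coef_add c d in
              if Z.eqb s.1 0 then padd p' q' else (s, m) :: padd p' q'
      | Gt => (c, m) :: padd p' q
      | Lt => (d, n) :: aux q'
      end
  end.

Definition pterm (t : coef * mono) (q : lpoly) : lpoly :=
  if Z.eqb t.1.1 0 then [::]
  else [seq (coef_mul t.1 s.1, mono_mul t.2 s.2) | s <- q].

Definition pmul (p q : lpoly) : lpoly :=
  foldr (fun t acc => padd (pterm t q) acc) [::] p.

Definition pscale (c : coef) (p : lpoly) : lpoly :=
  [seq (coef_mul c s.1, s.2) | s <- p].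

Definition psub (p q : lpoly) : lpoly := padd p (pscale ((-1)%BZ, 0%N) q).

Definition psum (l : seq lpoly) : lpoly := foldr padd [::] l.

Definition pone : lpoly := [:: ((1%BZ, 0%N), (0%BZ, 0%BZ, [::]))].
Definition patom (v : atom) : lpoly :=
  [:: ((1%BZ, 0%N), (0%BZ, 0%BZ, [:: (v, 1%N)]))].
Definition punit (a b : Z) : lpoly := [:: ((1%BZ, 0%N), (a, b, [::]))].

(* The triples (n, v, l') such that n * (l' * v') sums up to the derivative
   of l. *)
Fixpoint powers_der (l : powers) : seq (nat * atom * powers) :=
  if l is (v, n) :: l' then
    (n, v, if n is n'.+2 then (v, n'.+1) :: l' else l')
      :: [seq (t.1, (v, n) :: t.2) | t <- powers_der l']
  else [::].

Record derivation := Derivation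
  { der_u1 : lpoly; der_u2 : lpoly; der_atom : atom -> lpoly }.

Definition term_der (d : derivation) (t : coef * mono) : lpoly :=
  let: (c, (a, b, l)) := t in
  padd (pterm (coef_mul c (a, 0%N), (Z.sub a 1, b, l)) (der_u1 d))
  (padd (pterm (coef_mul c (b, 0%N), (a, Z.sub b 1, l)) (der_u2 d))
  (psum [seq pterm (coef_mul c (Z.of_nat u.1.1, 0%N), (a, b, u.2))
               (der_atom d u.1.2) | u <- powers_der l])).

Definition pder (d : derivation) (p : lpoly) : lpoly :=
  psum [seq term_der d t | t <- p].

Record env (R : Type) := Env { env_u1 : R; env_u2 : R; env_atom : atom -> R }.

(** * Evaluation of Laurent polynomials and its soundness *)

Section Evaluation.
Variable R : numFieldType.
Implicit Types (e : env R) (p q : lpoly) (v w : atom).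

Definition ratZ (z : Z) : R := (int_of_Z z)%:~R.

Lemma ratZD a b : ratZ (Z.add a b) = ratZ a + ratZ b.
Proof. by rewrite /ratZ (rmorphD int_of_Z) rmorphD. Qed.

Lemma ratZM a b : ratZ (Z.mul a b) = ratZ a * ratZ b.
Proof. by rewrite /ratZ (rmorphM int_of_Z) rmorphM. Qed.

Lemma ratZ_nat n : ratZ (Z.of_nat n) = n%:R.
Proof. by rewrite /ratZ -[Z.of_nat n]/(Z_of_int (Posz n)) Z_of_intK. Qed.

Lemma ratZ_pow30 n : ratZ (pow30 n) = 30 ^+ n.
Proof. by elim: n => // n IH; rewrite -[pow30 _]/(Z.mul 30 (pow30 n)) ratZM IH exprS. Qed.

Definition evc (c : coef) : R := ratZ c.1 / 30 ^+ c.2.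

Lemma pow30_neq0 n : 30 ^+ n != 0 :> R.
Proof. by rewrite expf_neq0 // pnatr_eq0. Qed.

Lemma evcD c d : evc (coef_add c d) = evc c + evc d.
Proof.
case: c d => [a e] [b f]; rewrite /evc /coef_add /=.
case: (leqP e f) => [ef|/ltnW fe] /=; rewrite ratZD ratZM ratZ_pow30 mulrDl.
- congr (_ + _); apply: (mulIf (pow30_neq0 f)); rewrite divfK ?pow30_neq0 //.
  by rewrite -{2}(subnKC ef) exprD mulrA divfK ?pow30_neq0.
- congr (_ + _); apply: (mulIf (pow30_neq0 e)); rewrite divfK ?pow30_neq0 //.
  by rewrite -{2}(subnKC fe) exprD mulrA divfK ?pow30_neq0.
Qed.

Lemma evcM c d : evc (coef_mul c d) = evc c * evc d.
Proof. by rewrite /evc /= ratZM exprD invfM mulrACA. Qed.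

Lemma evc_eq0 c : Z.eqb c.1 0 -> evc c = 0.
Proof. by move=> /Z.eqb_eq c0; rewrite /evc c0 mul0r. Qed.

Definition unit_env e := env_u1 e != 0 /\ env_u2 e != 0.

Definition evl e (l : powers) : R :=
  foldr (fun x acc => env_atom e x.1 ^+ x.2 * acc) 1 l.

Definition evm e (m : mono) : R :=
  env_u1 e ^ int_of_Z m.1.1 * env_u2 e ^ int_of_Z m.1.2 * evl e m.2.

Definition ev e p : R := \sum_(t <- p) evc t.1 * evm e t.2.

Lemma seq_cmp_eq s t : seq_cmp s t = Eq -> s = t.
Proof.
elim: s t => [|a s IH] [|b t] //=.
by case: Nat.compare_spec => // -> /IH ->.
Qed.

Lemma atom_cmp_eq v w : atom_cmp v w = Eq -> v = w.
Proof.
move=> /seq_cmp_eq.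
by case: v w => [?|? ?|?|?|?] [?|? ?|?|?|?] //= [] *; subst.
Qed.

Lemma powers_cmp_eq l k : powers_cmp l k = Eq -> l = k.
Proof.
elim: l k => [|[v m] l IH] [|[w n] k] //=.
case vw : (atom_cmp v w) => //; rewrite (atom_cmp_eq vw).
by case: Nat.compare_spec => // -> /IH ->.
Qed.

Lemma mono_cmp_eq m n : mono_cmp m n = Eq -> m = n.
Proof.
case: m n => [[a b] l] [[a' b'] l'] /=.
case: Z.compare_spec => // ->; case: Z.compare_spec => // ->.
by move=> /powers_cmp_eq ->.
Qed.

Lemma evlM e l k : evl e (powers_mul l k) = evl e l * evl e k.
Proof.
elim: l k => [|[v m] l IH] k; first by case: k => *; rewrite /= mul1r.
elim: k => [|[w n] k IHk]; first by rewrite /= mulr1.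
rewrite /=; case vw : (atom_cmp v w) => /=.
- by rewrite IH (atom_cmp_eq vw) exprD; ring.
- by rewrite IH /=; ring.
- by rewrite -/(powers_mul ((v, m) :: l) k) IHk /=; ring.
Qed.

Lemma evmM e m n : unit_env e -> evm e (mono_mul m n) = evm e m * evm e n.
Proof.
case: m n => [[a b] l] [[a' b'] l'] [u1 u2]; rewrite /evm /= evlM.
by rewrite !(rmorphD int_of_Z) /= !expfzDr //; ring.
Qed.

Lemma ev_nil e : ev e [::] = 0. Proof. by rewrite /ev big_nil. Qed.

Lemma ev_cons e t p : ev e (t :: p) = evc t.1 * evm e t.2 + ev e p.
Proof. by rewrite /ev big_cons. Qed.

Lemma evD e p q : ev e (padd p q) = ev e p + ev e q.
Proof.
elim: p q => [|[c m] p IH] q; first by case: q => *; rewrite /= ev_nil add0r.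
elim: q => [|[d n] q IHq]; first by rewrite /= ev_nil addr0.
rewrite /=; case mn : (mono_cmp m n) => /=.
- rewrite (mono_cmp_eq mn) !ev_cons /=; have sE := evcD c d.
  case: ifP => [/evc_eq0 s0|_]; rewrite ?ev_cons /= IH; last by rewrite sE; ring.
  have {}s0 : evc c + evc d = 0 by rewrite -sE.
  by rewrite addrACA -mulrDl s0 mul0r add0r.
- by rewrite -/(padd ((c, m) :: p) q) ev_cons IHq !ev_cons /=; ring.
- by rewrite ev_cons IH !ev_cons /=; ring.
Qed.

Lemma ev_pterm e t p : unit_env e ->
  ev e (pterm t p) = evc t.1 * evm e t.2 * ev e p.
Proof.
move=> ue; rewrite /pterm; case: ifP => [/evc_eq0 ->|_].
  by rewrite ev_nil !mul0r.
elim: p => [|s p IH]; first by rewrite ev_nil mulr0.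
by rewrite /= !ev_cons /= IH evcM evmM //; ring.
Qed.

Lemma evM e p q : unit_env e -> ev e (pmul p q) = ev e p * ev e q.
Proof.
move=> ue; elim: p => [|t p IH]; first by rewrite ev_nil mul0r.
by rewrite /= evD ev_pterm // IH ev_cons mulrDl.
Qed.

Lemma evZ e c p : ev e (pscale c p) = evc c * ev e p.
Proof.
elim: p => [|t p IH]; first by rewrite ev_nil mulr0.
by rewrite /= !ev_cons /= IH evcM; ring.
Qed.

Lemma evB e p q : ev e (psub p q) = ev e p - ev e q.
Proof. by rewrite evD evZ /evc /= divr1 mulN1r. Qed.

Lemma ev_psum e l : ev e (psum l) = \sum_(p <- l) ev e p.
Proof.
by elim: l => [|p l IH]; rewrite ?big_nil ?ev_nil //= evD IH big_cons.
Qed.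

Lemma evc1 : evc (1%BZ, 0%N) = 1. Proof. by rewrite /evc divr1. Qed.

Lemma ev_one e : ev e pone = 1.
Proof. by rewrite ev_cons ev_nil evc1 /evm /= !mulr1 addr0. Qed.

Lemma ev_atom e v : ev e (patom v) = env_atom e v.
Proof. by rewrite ev_cons ev_nil evc1 /evm /= !mul1r expr1 mulr1 addr0. Qed.

Lemma ev_unit e a b :
  ev e (punit a b) = env_u1 e ^ int_of_Z a * env_u2 e ^ int_of_Z b.
Proof. by rewrite ev_cons ev_nil evc1 /evm /= !mul1r mulr1 addr0. Qed.

Definition peqb p q := nilp (psub p q).

Lemma peqbP e p q : peqb p q -> ev e p = ev e q.
Proof.
by move=> /nilP pq; apply/eqP; rewrite -subr_eq0 -evB pq ev_nil.
Qed.

(* no occurrence of u2 and only atoms satisfying [ok] *)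
Definition only_atoms (ok : atom -> bool) p : bool :=
  all (fun t : coef * mono =>
    Z.eqb t.2.1.2 0 && all (fun x : atom * nat => ok x.1) t.2.2) p.

(** Transports values between models: the same polynomial is read with [u2] equal to e^{2 phi}, to
    the ambient t, or to 1, and agreement is needed only on the atoms that occur. *)
Lemma eq_ev (ok : atom -> bool) e e' p : only_atoms ok p ->
  env_u1 e = env_u1 e' -> (forall v, ok v -> env_atom e v = env_atom e' v) ->
  ev e p = ev e' p.
Proof.
move=> + u1E atE; elim: p => [|t p IH]; first by rewrite !ev_nil.
rewrite /= => /andP[/andP[/Z.eqb_eq t0 okt] /IH pE]; rewrite !ev_cons pE.
congr (_ * _ + _); rewrite /evm t0 u1E /= !expr0z !mulr1; congr (_ * _).
by elim: (t.2.2) okt => //= x l IHl /andP[/atE -> /IHl ->].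
Qed.

Lemma ev_term_der e d c a b l : unit_env e ->
  ev e (term_der d (c, (a, b, l))) = evc c *
   (ratZ a * env_u1 e ^ (int_of_Z a - 1) * ev e (der_u1 d)
      * (env_u2 e ^ int_of_Z b) * evl e l
    + env_u1 e ^ int_of_Z a * (ratZ b * env_u2 e ^ (int_of_Z b - 1)
      * ev e (der_u2 d)) * evl e l
    + env_u1 e ^ int_of_Z a * env_u2 e ^ int_of_Z b *
      \sum_(t <- powers_der l)
         t.1.1%:R * evl e t.2 * ev e (der_atom d t.1.2)).
Proof.
move=> ue; rewrite /term_der !evD !ev_pterm // ev_psum big_map !evcM /evm /=.
have evcz z : evc (z, 0%N) = ratZ z by rewrite /evc divr1.
have int_of_ZB1 z : int_of_Z (Z.sub z 1) = int_of_Z z - 1.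
  exact: (rmorphB int_of_Z z 1).
rewrite !evcz !int_of_ZB1.
set s := \sum_(t <- _) _; have -> : s = evc c *
    (env_u1 e ^ int_of_Z a * env_u2 e ^ int_of_Z b *
      \sum_(t <- powers_der l)
         t.1.1%:R * evl e t.2 * ev e (der_atom d t.1.2)).
  rewrite [RHS]mulrA [RHS]mulr_sumr; apply: eq_bigr => t _.
  by rewrite ev_pterm // evcM evcz ratZ_nat /evm /=; ring.
by ring.
Qed.

End Evaluation.

(** * Partial derivatives *)

Lemma near_eq_differentiable (R : numFieldType) (V W : normedModType R)
    (f g : V -> W) (a : V) :
  {near a, f =1 g} -> differentiable f a -> differentiable g a.
Proof.
move=> fg df.
have cf : continuous ('d f a) := diff_continuous df.
suff gE : g \o shift a = cst (g a) + 'd f a +o_ 0 id.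
  by apply/diff_locallyP; rewrite (diff_unique cf gE).
have /eqaddoP fE := diff_locally df.
apply/eqaddoP => eps eps0; have fg0 : \forall h \near 0, f (h + a) = g (h + a).
  have /= := near_shift 0 a (fun x => f x = g x); rewrite subr0 => <-.
  exact: fg.
move: fg0 (fE _ eps0); apply: filterS2 => h /= fgh.
by rewrite !fctE /= (nbhs_singleton fg) fgh.
Qed.

Section Partials.
Variables (R : realType) (n : nat).
Implicit Types (F G : 'rV[R]_n -> R) (p : 'rV[R]_n) (D : set 'rV[R]_n).

Lemma eq_on_near D F G p : open D -> (forall q, D q -> F q = G q) -> D p ->
  \forall q \near p, F q = G q.
Proof.
move=> Dopen FG Dp; apply: (filterS FG).
exact: open_nbhs_nbhs.
Qed.

Lemma eq_on_partial D F G p i : open D -> (forall q, D q -> F q = G q) ->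
  D p -> partial i F p = partial i G p.
Proof. by move=> Dopen FG Dp; apply: near_eq_derive; apply: eq_on_near Dp. Qed.

Lemma eq_on_differentiable D F G p : open D -> (forall q, D q -> F q = G q) ->
  D p -> differentiable F p -> differentiable G p.
Proof.
by move=> Dopen FG Dp; apply: near_eq_differentiable; apply: eq_on_near Dp.
Qed.


(** Differentiability travels with the values of the partial derivatives because the product and
    chain rules consume both. *)
Definition has_partials F p (dF : 'I_n -> R) : Prop :=
  differentiable F p /\ forall i, partial i F p = dF i.

Lemma eq_has_partials D F G p dF dG : open D -> (forall q, D q -> F q = G q) ->
  D p -> (forall i, dF i = dG i) -> has_partials F p dF -> has_partials G p dG.
Proof.
move=> Dopen FG Dp dFG [dFp dFE]; split.
  exact: (eq_on_differentiable Dopen FG).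
by move=> i; rewrite -dFG -dFE -(eq_on_partial i Dopen FG).
Qed.

Lemma has_partials_cst c p : has_partials (cst c) p (fun=> 0).
Proof.
by split=> [|i]; [exact: differentiable_cst|rewrite /partial derive_cst].
Qed.

Lemma has_partialsD F G p dF dG : has_partials F p dF -> has_partials G p dG ->
  has_partials (fun q => F q + G q) p (fun i => dF i + dG i).
Proof.
move=> [dFp FE] [dGp GE]; split=> [|i]; first exact: differentiableD.
by rewrite -FE -GE /partial deriveD //; exact: diff_derivable.
Qed.

Lemma has_partialsM F G p dF dG : has_partials F p dF -> has_partials G p dG ->
  has_partials (fun q => F q * G q) p (fun i => dF i * G p + F p * dG i).
Proof.
move=> [dFp FE] [dGp GE]; split=> [|i]; first exact: differentiableM.
rewrite -FE -GE /partial [LHS]deriveM; try exact: diff_derivable.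
by rewrite addrC [X in X + _]mulrC.
Qed.

Lemma has_partials_comp (g : R -> R) F p dg dF : is_derive (F p) 1 g dg ->
  has_partials F p dF ->
  has_partials (fun q => g (F q)) p (fun i => dg * dF i).
Proof.
move=> [gder gE] [dFp FE].
have dgF : differentiable g (F p) by apply/derivable1_diffP.
split=> [|i]; first exact: (differentiable_comp dFp dgF).
rewrite -FE /partial [LHS]deriveE; last exact: (differentiable_comp dFp dgF).
rewrite (diff_comp dFp dgF) /= diff1E // derive1E gE -deriveE //.
by rewrite mulrC.
Qed.

Lemma has_partialsX F p dF m : has_partials F p dF ->
  has_partials (fun q => F q ^+ m) p (fun i => m%:R * F p ^+ m.-1 * dF i).
Proof.
apply: (@has_partials_comp (fun x => x ^+ m)).
apply: DeriveDef; first exact: exprn_derivable.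
by rewrite exp_derive /GRing.scale /= mulr1.
Qed.

Lemma has_partialsV F p dF : F p != 0 -> has_partials F p dF ->
  has_partials (fun q => (F q)^-1) p (fun i => - F p ^- 2 * dF i).
Proof.
move=> F0; apply: (@has_partials_comp (fun x => x^-1)).
apply: DeriveDef; first exact: derivableV.
by rewrite deriveV // derive_id /GRing.scale /= mulr1.
Qed.

Lemma has_partialsXz F p dF (z : int) : F p != 0 -> has_partials F p dF ->
  has_partials (fun q => F q ^ z) p (fun i => z%:~R * F p ^ (z - 1) * dF i).
Proof.
move=> F0 dFp; case: z => m.
  have [dm mE] := has_partialsX m dFp; split=> // i; rewrite mE.
  by case: m {dm mE} => [|m]; rewrite ?mul0r // subzSS subr0.
have [dm mE] := has_partialsV (expf_neq0 m.+1 F0) (has_partialsX m.+1 dFp).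
have m1 : Negz m - 1 = Negz m.+1 by lia.
split=> // i; rewrite mE /= m1 -[F p ^ Negz _]/(F p ^- m.+2).
rewrite NegzE mulrNz -[(Posz m.+1)%:~R]/(m.+1%:R) -exprM.
rewrite !mulNr mulrA; congr (- (_ * _)); rewrite mulrCA; congr (_ * _).
apply: (mulfI (expf_neq0 (m.+1 * 2) F0)); rewrite mulrA mulfV ?expf_neq0 // mul1r.
have -> : (m.+1 * 2 = m.+2 + m)%N by lia.
by rewrite exprD mulrAC mulfV ?expf_neq0 // mul1r.
Qed.

(** ** Symmetry of second derivatives *)

Lemma is_derive_line F p i (t : R) :
  differentiable F (p + t *: delta_mx 0 i) ->
  is_derive t 1 (fun s : R => F (p + s *: delta_mx 0 i))
    (partial i F (p + t *: delta_mx 0 i)).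
Proof.
move=> dF; have := @diff_derivable _ _ _ F _ (delta_mx 0 i) dF.
rewrite /partial /derive /derivable.
set A := (X in cvg (X @ _)); set B := (X in is_derive _ _ X _).
have AE : A = fun h => h^-1 *: ((B \o shift t) (h *: 1) - B t).
  rewrite /A /B funeqE => h /=; congr (_ *: (F _ - _)).
  by rewrite [h *: 1]mulr1 scalerDl addrCA.
rewrite AE => cv; apply: DeriveDef => //.
by rewrite -[RHS]/(lim (A @ 0^')) AE.
Qed.

Lemma mean_value_line F p i (h : R) : 0 < h ->
  (forall t, 0 <= t <= h -> differentiable F (p + t *: delta_mx 0 i)) ->
  exists2 t, 0 < t < h & F (p + h *: delta_mx 0 i) - F p =
                         partial i F (p + t *: delta_mx 0 i) * h.
Proof.
move=> h0 dF; pose g (t : R) := F (p + t *: delta_mx 0 i).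
have dg t : 0 <= t <= h -> is_derive t 1 g (partial i F (p + t *: delta_mx 0 i)).
  by move=> /dF; exact: is_derive_line.
have dg' t : t \in `]0, h[ -> is_derive t 1 g (partial i F (p + t *: delta_mx 0 i)).
  by rewrite in_itv /= => /andP[t0 th]; apply: dg; rewrite !ltW.
have cg : {within `[0, h], continuous g}.
  by apply: derivable_within_continuous => t; rewrite in_itv /= => /dg [].
have [t] := MVT h0 dg' cg.
by rewrite in_itv /= /g scale0r addr0 subr0 => ?; exists t.
Qed.

(** The mean value theorem is applied twice: in direction i to the difference of F along two
    parallel edges of the square, then in direction j to [partial i F]. *)
Lemma second_difference F p i j (h : R) : 0 < h ->
  (forall s t, 0 <= s <= h -> 0 <= t <= h ->
    differentiable F (p + s *: delta_mx 0 i + t *: delta_mx 0 j) /\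
    differentiable (partial i F) (p + s *: delta_mx 0 i + t *: delta_mx 0 j)) ->
  exists s t, [/\ 0 < s < h, 0 < t < h &
    F (p + h *: delta_mx 0 i + h *: delta_mx 0 j) - F (p + h *: delta_mx 0 i)
      - (F (p + h *: delta_mx 0 j) - F p) =
    partial j (partial i F) (p + s *: delta_mx 0 i + t *: delta_mx 0 j)
      * h * h].
Proof.
move=> h0 dF; set ei : 'rV[R]_n := delta_mx 0 i; set ej : 'rV[R]_n := delta_mx 0 j.
have hge0 := ltW h0.
have le0 : (0 : R) <= 0 <= h by rewrite hge0 !lexx.
have leh : 0 <= h <= h by rewrite hge0 !lexx.
have dline t : 0 <= t <= h -> forall s, 0 <= s <= h ->
    is_derive s 1 (fun s : R => F (p + t *: ej + s *: ei))
      (partial i F (p + s *: ei + t *: ej)).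
  move=> th s sh; rewrite addrAC; apply: is_derive_line.
  by rewrite addrAC; apply: (dF s t sh th).1.
pose g (s : R) := F (p + h *: ej + s *: ei) - F (p + 0 *: ej + s *: ei).
have dg s : 0 <= s <= h -> is_derive s 1 g
    (partial i F (p + s *: ei + h *: ej) - partial i F (p + s *: ei + 0 *: ej)).
  by move=> sh; apply: is_deriveB; exact: dline.
have dg' s : s \in `]0, h[ -> is_derive s 1 g
    (partial i F (p + s *: ei + h *: ej) - partial i F (p + s *: ei + 0 *: ej)).
  by rewrite in_itv /= => /andP[? ?]; apply: dg; rewrite !ltW.
have cg : {within `[0, h], continuous g}.
  by apply: derivable_within_continuous => s; rewrite in_itv /= => /dg [].
have [s sh gE] := MVT h0 dg' cg.
move: sh; rewrite in_itv /= => sh.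
have sh' : 0 <= s <= h by case/andP: sh => ? ?; rewrite !ltW.
have [t th tE] := @mean_value_line (partial i F) (p + s *: ei) j h h0
   (fun t th => (dF s t sh' th).2).
exists s, t; split=> //.
rewrite -tE -/ei -/ej; move: gE; rewrite /g !scale0r !addr0 subr0 => <-.
by rewrite [p + h *: ei + _]addrAC; ring.
Qed.

(** The second difference over a small square is symmetric in i and j, so the two mixed derivatives
    take a common value at two points of the square. By continuity that value is closer to each of a
    and b than half their distance, which is absurd unless a = b. *)
Lemma partial_comm D F p i j : open D -> D p -> smooth_on D F ->
  partial i (partial j F) p = partial j (partial i F) p.
Proof.
move=> Dopen Dp sF; set a := LHS; set b := RHS.
apply: contrapT => /eqP ab; pose eps := `|a - b| / 2.
have eps0 : 0 < eps by rewrite divr_gt0 // normr_gt0 subr_eq0.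
have ca : {for p, continuous (partial i (partial j F))}.
  exact/differentiable_continuous/(sF [:: i; j]).
have cb : {for p, continuous (partial j (partial i F))}.
  exact/differentiable_continuous/(sF [:: j; i]).
have nD : \forall q \near p, D q by exact: open_nbhs_nbhs.
have /nbhs_ballP[del /= del0 delP] : \forall q \near p,
    [/\ D q, `|a - partial i (partial j F) q| < eps
      & `|b - partial j (partial i F) q| < eps].
  have na : nbhs p (fun q => `|a - partial i (partial j F) q| < eps).
    exact: (@cvgr_dist_lt _ _ _ _ _ _ _ ca _ eps0).
  have nb : nbhs p (fun q => `|b - partial j (partial i F) q| < eps).
    exact: (@cvgr_dist_lt _ _ _ _ _ _ _ cb _ eps0).
  have FF : Filter (nbhs p) := nbhs_filter p.
  have := @filterI _ _ FF _ _ nD (@filterI _ _ FF _ _ na nb).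
  by apply: (@filterS _ _ FF) => q [Dq [aq bq]]; split.
pose ei : 'rV[R]_n := delta_mx 0 i; pose ej : 'rV[R]_n := delta_mx 0 j.
(* The summand 1 keeps N positive and makes the square of side h = del / N lie strictly inside the
   ball of radius del. *)
pose N := `|ei| + `|ej| + 1; have N0 : 0 < N by rewrite ltr_wpDl.
pose h := del / N; have h0 : 0 < h by rewrite divr_gt0.
have inD s t : 0 <= s <= h -> 0 <= t <= h -> ball p del (p + s *: ei + t *: ej).
  move=> /andP[s0 sh] /andP[t0 th]; rewrite -ball_normE /= -addrA opprD addrA subrr.
  rewrite sub0r normrN (le_lt_trans (ler_normD _ _)) // !normrZ !ger0_norm //.
  have : h * N = del by rewrite divfK ?gt_eqF.
  have := ler_wpM2r (normr_ge0 ei) sh; have := ler_wpM2r (normr_ge0 ej) th.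
  by rewrite /N !mulrDr mulr1 => *; lra.
clearbody h a b.
have dF s t : 0 <= s <= h -> 0 <= t <= h ->
    differentiable F (p + s *: ei + t *: ej) /\
    differentiable (partial i F) (p + s *: ei + t *: ej).
  move=> sh th; have [Dq _ _] := delP _ (inD s t sh th).
  by split; [exact: (sF [::])|exact: (sF [:: i])].
have inD' s t : 0 <= s <= h -> 0 <= t <= h -> ball p del (p + s *: ej + t *: ei).
  by move=> sh th; rewrite addrAC; exact: inD.
have dF' s t : 0 <= s <= h -> 0 <= t <= h ->
    differentiable F (p + s *: ej + t *: ei) /\
    differentiable (partial j F) (p + s *: ej + t *: ei).
  move=> sh th; have [Dq _ _] := delP _ (inD' s t sh th).
  by split; [exact: (sF [::])|exact: (sF [:: j])].
have [s [t [/andP[s0 sh] /andP[t0 th] stE]]] := second_difference h0 dF.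
have [s' [t' [/andP[s0' sh'] /andP[t0' th'] stE']]] := second_difference h0 dF'.
have lew (u : R) : 0 < u -> u < h -> 0 <= u <= h.
  by move=> u0 uh; rewrite !ltW.
have [_ _ bE] := delP _ (inD s t (lew _ s0 sh) (lew _ t0 th)).
have [_ aE _] := delP _ (inD' s' t' (lew _ s0' sh') (lew _ t0' th')).
have hh : h * h != 0 by rewrite mulf_neq0 ?gt_eqF.
have ABE : partial j (partial i F) (p + s *: ei + t *: ej) =
           partial i (partial j F) (p + s' *: ej + t' *: ei).
  move: stE stE'; rewrite -/ei -/ej [p + h *: ej + _]addrAC.
  move: (partial j _ _) (partial i _ _) => A B AE BE.
  by apply: (mulIf hh); rewrite !mulrA -AE -BE; ring.
move: bE aE; rewrite ABE; move: (partial i _ _) => X bE aE.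
have : `|a - b| < eps + eps.
  apply: le_lt_trans (ltrD aE bE); rewrite [`|b - X|]distrC.
  have -> : a - b = (a - X) + (X - b) by ring.
  exact: ler_normD.
by rewrite /eps -splitr ltxx.
Qed.

End Partials.

(** * Functions represented by Laurent polynomials *)

(** The bridge between symbols and functions: every variable evaluates along [E] to a differentiable
    function whose partial derivatives are values of polynomials, so differentiation stays inside
    the ring. The derivations are indexed by naturals, as the tables are, to keep ordinals out of
    the computations. *)
Record jet_model (R : realType) n (D : set 'rV[R]_n) (E : 'rV[R]_n -> env R)
    (d : nat -> derivation) : Prop := JetModel
  { jm_open : open D;
    jm_unit : forall p, D p -> unit_env (E p);
    jm_u1 : forall p, D p -> has_partials (fun q => env_u1 (E q)) p
              (fun i => ev (E p) (der_u1 (d i)));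
    jm_u2 : forall p, D p -> has_partials (fun q => env_u2 (E q)) p
              (fun i => ev (E p) (der_u2 (d i)));
    jm_atom : forall v p, D p -> has_partials (fun q => env_atom (E q) v) p
              (fun i => ev (E p) (der_atom (d i) v)) }.

Section Model.
Variables (R : realType) (n : nat) (D : set 'rV[R]_n) (E : 'rV[R]_n -> env R).
Variable d : nat -> derivation.
Hypothesis M : jet_model D E d.
Implicit Types (p : 'rV[R]_n) (P : lpoly).

Lemma evl_has_partials l p : D p -> has_partials (fun q => evl (E q) l) p
  (fun i => \sum_(t <- powers_der l)
     t.1.1%:R * evl (E p) t.2 * ev (E p) (der_atom (d i) t.1.2)).
Proof.
move=> Dp; elim: l => [|[v m] l IH].
  have [dc cE] := has_partials_cst 1 p; split=> // i; rewrite cE.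
  by rewrite big_nil.
have [dF FE] := has_partialsM (has_partialsX m (jm_atom M v Dp)) IH.
split=> [//|i]; rewrite FE /= big_cons big_map /=; congr (_ + _).
  by case: m {dF FE} => [|[|m]] /=; ring.
rewrite mulr_sumr; apply: eq_bigr => t _; ring.
Qed.

Lemma ev_has_partials P p : D p ->
  has_partials (fun q => ev (E q) P) p (fun i => ev (E p) (pder (d i) P)).
Proof.
move=> Dp; have up := jm_unit M Dp; have [up1 up2] := up.
elim: P => [|[c [[a b] l]] P [dP PE]].
  apply: (eq_has_partials (jm_open M) _ Dp _ (has_partials_cst 0 p)) => [q _|i];
    exact: esym (ev_nil _).
have h1 := has_partialsXz (int_of_Z a) up1 (jm_u1 M Dp).
have h2 := has_partialsXz (int_of_Z b) up2 (jm_u2 M Dp).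
have h := has_partialsM (has_partials_cst (evc R c) p)
            (has_partialsM (has_partialsM h1 h2) (evl_has_partials l Dp)).
apply: (eq_has_partials (jm_open M) _ Dp _ (has_partialsD h (conj dP PE))).
  by move=> q _; rewrite ev_cons /evm.
move=> i; rewrite /pder /= evD ev_term_der // /cst /ratZ; congr (_ + _).
by ring.
Qed.

Definition rep (F : 'rV[R]_n -> R) P := forall p, D p -> F p = ev (E p) P.

Lemma rep_has_partials F P p : rep F P -> D p ->
  has_partials F p (fun i => ev (E p) (pder (d i) P)).
Proof.
move=> FP Dp; apply: (eq_has_partials (jm_open M) _ Dp _ (ev_has_partials P Dp)).
  by move=> q Dq; rewrite FP.
by [].
Qed.

Lemma rep_partial F P i : rep F P -> rep (partial i F) (pder (d i) P).
Proof. by move=> FP p Dp; have [_ ->] := rep_has_partials FP Dp. Qed.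

Definition pders (s : seq 'I_n) P := foldr (fun i : 'I_n => pder (d i)) P s.

Lemma rep_partials F P s : rep F P -> rep (partials s F) (pders s P).
Proof. by move=> FP; elim: s => //= i s; exact: rep_partial. Qed.

(** Every iterated partial derivative of a represented function is represented, hence
    differentiable. *)
Lemma rep_smooth F P : rep F P -> smooth_on D F.
Proof.
by move=> FP s p Dp; have [] := rep_has_partials (rep_partials s FP) Dp.
Qed.

End Model.

(** * Symbolic tensor calculus *)

(** Tensors are stored as nested lists and not as functions of the indices, so that a component once
    computed is looked up rather than recomputed. *)
Definition tab1 {T : Type} (n : nat) (F : nat -> T) : seq T :=
  [seq F i | i <- iota 0 n].
Definition tab2 {T : Type} n (F : nat -> nat -> T) :=
  tab1 n (fun i => tab1 n (F i)).
Definition tab3 {T : Type} n (F : nat -> nat -> nat -> T) :=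
  tab1 n (fun i => tab2 n (F i)).
Definition tab4 {T : Type} n (F : nat -> nat -> nat -> nat -> T) :=
  tab1 n (fun i => tab3 n (F i)).

Definition table2 : Type := seq (seq lpoly).
Definition table3 : Type := seq table2.
Definition table4 : Type := seq table3.

Definition at2 (t : table2) i j : lpoly := nth [::] (nth [::] t i) j.
Definition at3 (t : table3) i j k : lpoly := at2 (nth [::] t i) j k.
Definition at4 (t : table4) i j k l : lpoly := at3 (nth [::] t i) j k l.

(** In the encoding z / 30^e: 15/30, 225/900 and 3/30. *)
Definition const_half : coef := (15%BZ, 1%N).
Definition const_quarter : coef := (225%BZ, 2%N).
Definition const_tenth : coef := (3%BZ, 1%N).

Section SymbolicTensors.
Variables (n : nat) (d : nat -> derivation).
Notation psumn F := (psum (tab1 n F)).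
Implicit Types (g gi T : table2) (G : table3).

Definition sym_mul (a b : table2) : table2 :=
  tab2 n (fun i j => psumn (fun k => pmul (at2 a i k) (at2 b k j))).

Definition sym_christoffel g gi : table3 :=
  let dg := tab3 n (fun k i j => pder (d k) (at2 g i j)) in
  let low := tab3 n (fun i j l =>
    psub (padd (at3 dg i j l) (at3 dg j i l)) (at3 dg l i j)) in
  tab3 n (fun k i j => pscale const_half
    (psumn (fun l => pmul (at2 gi k l) (at3 low i j l)))).

(** Separate from the table because the Ricci tensor needs only the n^3 components R^k_{jkl}; the
    full table serves the Weyl tensor. In the same way [sym_cotton_entry] allows a single Cotton
    component to be computed for a rescaled metric. *)
Definition sym_riemann_up_entry G m j k l : lpoly :=
  padd (psub (pder (d k) (at3 G m l j)) (pder (d l) (at3 G m k j)))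
   (psumn (fun a => psub (pmul (at3 G m k a) (at3 G a l j))
                         (pmul (at3 G m l a) (at3 G a k j)))).

Definition sym_riemann_up G : table4 := tab4 n (sym_riemann_up_entry G).

Definition sym_ricci G : table2 :=
  tab2 n (fun j l => psumn (fun k => sym_riemann_up_entry G k j k l)).

Definition sym_scal gi (rc : table2) : lpoly :=
  psumn (fun i => psumn (fun j => pmul (at2 gi i j) (at2 rc i j))).

(* [const_quarter] and [const_tenth] are 1/(n-2) and 1/(2(n-1)) for n = 6. *)
Definition sym_schouten g (rc : table2) (sc : lpoly) : table2 :=
  tab2 n (fun i j => pscale const_quarter
    (psub (at2 rc i j) (pmul (pscale const_tenth sc) (at2 g i j)))).

Definition sym_riemann g (Ru : table4) : table4 :=
  tab4 n (fun i j k l => psumn (fun m => pmul (at2 g i m) (at4 Ru m j k l))).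

Definition sym_weyl g (Rm : table4) (P : table2) : table4 :=
  tab4 n (fun i j k l => psub (at4 Rm i j k l)
    (psub (psub (padd (pmul (at2 g i k) (at2 P j l))
                      (pmul (at2 g j l) (at2 P i k)))
                (pmul (at2 g i l) (at2 P j k)))
          (pmul (at2 g j k) (at2 P i l)))).

Definition sym_nabla2 G T i j k : lpoly :=
  psub (psub (pder (d k) (at2 T i j))
    (psumn (fun m => pmul (at3 G m k i) (at2 T m j))))
    (psumn (fun m => pmul (at3 G m k j) (at2 T i m))).

Definition sym_nabla3 G (T : table3) : table4 :=
  tab4 n (fun i j k l => psub (psub (psub (pder (d l) (at3 T i j k))
    (psumn (fun m => pmul (at3 G m l i) (at3 T m j k))))
    (psumn (fun m => pmul (at3 G m l j) (at3 T i m k))))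
    (psumn (fun m => pmul (at3 G m l k) (at3 T i j m)))).

Definition sym_cotton_entry G P i j k : lpoly :=
  psub (sym_nabla2 G P i j k) (sym_nabla2 G P i k j).

Definition sym_cotton G P : table3 := tab3 n (sym_cotton_entry G P).

Definition sym_bach gi (NC : table4) (PU : table2) (W : table4) : table2 :=
  tab2 n (fun i j => psub
    (psumn (fun k => psumn (fun l => pmul (at2 gi k l) (at4 NC i j k l))))
    (psumn (fun k => psumn (fun l => pmul (at2 PU k l) (at4 W k i j l))))).

End SymbolicTensors.

Lemma nth_tab1 T (x : T) n F i : (i < n)%N -> nth x (tab1 n F) i = F i.
Proof.
by move=> i_n; rewrite (nth_map 0%N) ?size_iota // nth_iota // add0n.
Qed.

Section TableEntries.
Variable n : nat.
Implicit Types i j k l : 'I_n.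

Lemma at_tab2 (F : nat -> nat -> lpoly) i j : at2 (tab2 n F) i j = F i j.
Proof. by rewrite /at2 !nth_tab1. Qed.

Lemma at_tab3 (F : nat -> nat -> nat -> lpoly) i j k :
  at3 (tab3 n F) i j k = F i j k.
Proof. by rewrite /at3 nth_tab1 // at_tab2. Qed.

Lemma at_tab4 (F : nat -> nat -> nat -> nat -> lpoly) i j k l :
  at4 (tab4 n F) i j k l = F i j k l.
Proof. by rewrite /at4 nth_tab1 // at_tab3. Qed.

Lemma ev_sum (R : numFieldType) (e : env R) (F : nat -> lpoly) :
  ev e (psum (tab1 n F)) = \sum_(i < n) ev e (F i).
Proof. by rewrite ev_psum big_map -{1}(subn0 n) big_mkord. Qed.

End TableEntries.

(** * Tensor fields represented by tables of polynomials *)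

Section Representation.
Variables (R : realType) (n : nat) (D : set 'rV[R]_n) (E : 'rV[R]_n -> env R).
Variable d : nat -> derivation.
Hypothesis M : jet_model D E d.

Definition rep2 (T : 'rV[R]_n -> 'M[R]_n) (t : table2) :=
  forall i j : 'I_n, rep D E (fun p => T p i j) (at2 t i j).
Definition rep3 (T : 'rV[R]_n -> 'I_n -> 'I_n -> 'I_n -> R) (t : table3) :=
  forall i j k : 'I_n, rep D E (fun p => T p i j k) (at3 t i j k).
Definition rep4 (T : 'rV[R]_n -> 'I_n -> 'I_n -> 'I_n -> 'I_n -> R)
    (t : table4) :=
  forall i j k l : 'I_n, rep D E (fun p => T p i j k l) (at4 t i j k l).

Lemma rep_mul S T s t : rep2 S s -> rep2 T t ->
  rep2 (fun p => S p *m T p) (sym_mul n s t).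
Proof.
move=> Ss Tt i j p Dp; rewrite mxE at_tab2 ev_sum.
by apply: eq_bigr => k _; rewrite evM ?(Ss i k p) ?(Tt k j p) //; exact: (jm_unit M Dp).
Qed.

Variables (g : 'rV[R]_n -> 'M[R]_n) (gs gis : table2).
Hypotheses (gE : rep2 g gs) (giE : rep2 (fun p => invmx (g p)) gis).
Let G := sym_christoffel n d gs gis.

Lemma evc_half : evc R const_half = 2^-1.
Proof. by rewrite /evc -[ratZ _ _]/(15%:R : R) expr1; field. Qed.

Lemma rep_christoffel : rep3 (christoffel g) G.
Proof.
move=> k i j p Dp; have up := jm_unit M Dp.
rewrite /christoffel /G /sym_christoffel at_tab3 evZ evc_half ev_sum.
congr (_ * _); apply: eq_bigr => l _; rewrite evM // -giE //; congr (_ * _).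
rewrite !at_tab3 !evB !evD.
by rewrite !(rep_partial M _ (gE _ _) Dp).
Qed.

Lemma rep_riemann_up_entry m j k l : rep D E
  (fun p => riemann_up g p m j k l) (sym_riemann_up_entry n d G m j k l).
Proof.
move=> p Dp; have up := jm_unit M Dp.
rewrite /riemann_up /sym_riemann_up_entry evD evB ev_sum.
rewrite !(rep_partial M _ (rep_christoffel _ _ _) Dp); congr (_ + _).
apply: eq_bigr => a _; rewrite evB !evM //.
by rewrite !(rep_christoffel _ _ _ Dp).
Qed.

Lemma rep_riemann_up : rep4 (riemann_up g) (sym_riemann_up n d G).
Proof.
by move=> m j k l p Dp; rewrite at_tab4; exact: rep_riemann_up_entry.
Qed.

Lemma rep_ricci : rep2 (ricci g) (sym_ricci n d G).
Proof.
move=> j l p Dp; rewrite mxE at_tab2 ev_sum.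
by apply: eq_bigr => k _; exact: rep_riemann_up_entry.
Qed.

Lemma rep_scal rc : rep2 (ricci g) rc -> rep D E (scal g) (sym_scal n gis rc).
Proof.
move=> rcE p Dp; have up := jm_unit M Dp.
rewrite /scal ev_sum; apply: eq_bigr => i _; rewrite ev_sum.
by apply: eq_bigr => j _; rewrite evM // (giE i j Dp) (rcE i j _ Dp).
Qed.

Lemma rep_riemann Ru : rep4 (riemann_up g) Ru ->
  rep4 (riemann g) (sym_riemann n gs Ru).
Proof.
move=> RuE i j k l p Dp; have up := jm_unit M Dp.
rewrite /riemann at_tab4 ev_sum; apply: eq_bigr => m _.
by rewrite evM // (gE i m Dp) (RuE m j k l _ Dp).
Qed.

Lemma rep_weyl Rm P : rep4 (riemann g) Rm -> rep2 (schouten g) P ->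
  rep4 (weyl g) (sym_weyl n gs Rm P).
Proof.
move=> RmE PE i j k l p Dp; have up := jm_unit M Dp.
rewrite /weyl at_tab4 !evB evD !evM //.
by rewrite !(gE _ _ Dp) !(PE _ _ _ Dp) (RmE _ _ _ _ _ Dp).
Qed.

Lemma rep_nabla2_entry T t i j k : rep2 T t ->
  rep D E (fun p => nabla2 g T p i j k) (sym_nabla2 n d G t i j k).
Proof.
move=> TE p Dp; have up := jm_unit M Dp.
rewrite /nabla2 /sym_nabla2 !evB !ev_sum (rep_partial M k (TE i j) Dp).
congr (_ - _ - _); apply: eq_bigr => m _.
  by rewrite evM // (rep_christoffel _ _ _ Dp) (TE _ _ _ Dp).
by rewrite evM // (rep_christoffel _ _ _ Dp) (TE _ _ _ Dp).
Qed.

Lemma rep_nabla3 T t : rep3 T t -> rep4 (nabla3 g T) (sym_nabla3 n d G t).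
Proof.
move=> TE i j k l p Dp; have up := jm_unit M Dp.
rewrite /nabla3 at_tab4 !evB !ev_sum (rep_partial M l (TE i j k) Dp).
congr (_ - _ - _ - _); apply: eq_bigr => m _.
- by rewrite evM // (rep_christoffel _ _ _ Dp) (TE _ _ _ _ Dp).
- by rewrite evM // (rep_christoffel _ _ _ Dp) (TE _ _ _ _ Dp).
- by rewrite evM // (rep_christoffel _ _ _ Dp) (TE _ _ _ _ Dp).
Qed.

Lemma rep_cotton_entry P i j k : rep2 (schouten g) P ->
  rep D E (fun p => cotton g p i j k) (sym_cotton_entry n d G P i j k).
Proof.
move=> PE p Dp; rewrite /cotton evB.
by rewrite (rep_nabla2_entry i j k PE Dp) (rep_nabla2_entry i k j PE Dp).
Qed.

Lemma rep_cotton P : rep2 (schouten g) P -> rep3 (cotton g) (sym_cotton n d G P).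
Proof. by move=> PE i j k p Dp; rewrite at_tab3; exact: rep_cotton_entry. Qed.

Lemma rep_bach P C NC PU W : rep3 (cotton g) C ->
  rep4 (nabla3 g (cotton g)) NC ->
  rep2 (raise2 g (schouten g)) PU -> rep4 (weyl g) W -> rep2 (schouten g) P ->
  rep2 (bach g) (sym_bach n gis NC PU W).
Proof.
move=> CE NCE PUE WE PE i j p Dp; have up := jm_unit M Dp.
rewrite mxE at_tab2 evB !ev_sum; congr (_ - _); apply: eq_bigr => k _;
  rewrite ev_sum; apply: eq_bigr => l _; rewrite evM //.
- by rewrite (giE k l Dp) (NCE _ _ _ _ _ Dp).
- by rewrite (PUE _ _ _ Dp) (WE _ _ _ _ _ Dp).
Qed.

End Representation.

Lemma rep_schouten (R : realType) (D : set 'rV[R]_6) E d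
    (g : 'rV[R]_6 -> 'M[R]_6) gs rc sc : jet_model D E d ->
  rep2 D E g gs -> rep2 D E (ricci g) rc -> rep D E (scal g) sc ->
  rep2 D E (schouten g) (sym_schouten 6 gs rc sc).
Proof.
move=> M gE rcE scE i j p Dp; have up := jm_unit M Dp.
rewrite at_tab2 evZ evB evM // evZ -(rcE i j p Dp) -(scE p Dp) -(gE i j p Dp).
rewrite /schouten; move: (ricci g p) => r; rewrite !mxE.
rewrite -[evc R const_quarter]/(225%:R / 30 ^+ 2 : R).
by rewrite -[evc R const_tenth]/(3%:R / 30 ^+ 1 : R); field.
Qed.

Definition eq_table2 n (s t : table2) : bool :=
  all (fun i => all (fun j => peqb (at2 s i j) (at2 t i j)) (iota 0 n))
    (iota 0 n).

Definition id_table n : table2 :=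
  tab2 n (fun i j => if i == j then pone else [::]).

Section TableTests.
Variables (R : realType) (n : nat) (D : set 'rV[R]_n) (E : 'rV[R]_n -> env R).
Variable d : nat -> derivation.
Hypothesis M : jet_model D E d.

Lemma eq_table2P e s t : eq_table2 n s t ->
  forall i j : 'I_n, ev (e : env R) (at2 s i j) = ev e (at2 t i j).
Proof.
move=> /allP st i j; apply: peqbP.
have mem (k : 'I_n) : (k : nat) \in iota 0 n by rewrite mem_iota ltn_ord.
by have /allP := st i (mem i); apply.
Qed.

Lemma rep2_eq0 T t p : rep2 D E T t -> eq_table2 n t [::] -> D p -> T p = 0.
Proof.
move=> Tt t0 Dp; apply/matrixP => i j; rewrite (Tt i j p Dp) (eq_table2P _ t0).
(* Entries of the empty table default to the empty list, which is the zero polynomial. *)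
by rewrite /at2 !nth_nil ev_nil mxE.
Qed.

(** The candidate inverse comes from outside and is certified by one product: a left inverse of a
    square matrix is its inverse, so no determinant has to be computed. *)
Lemma rep_invmx g gs gis : rep2 D E g gs ->
  eq_table2 n (sym_mul n gis gs) (id_table n) ->
  rep2 D E (fun p => invmx (g p)) gis /\ forall p, D p -> g p \in unitmx.
Proof.
move=> gE id_gs; pose h p := \matrix_(i < n, j < n) ev (E p) (at2 gis i j).
have hE : rep2 D E h gis by move=> i j p Dp; rewrite mxE.
have hg p : D p -> h p *m g p = 1%:M.
  move=> Dp; apply/matrixP => i j.
  rewrite (rep_mul M hE gE i j Dp) (eq_table2P _ id_gs) at_tab2 mxE.
  by rewrite -val_eqE; case: ifP => _; rewrite ?ev_one ?ev_nil.
have gU p (Dp : D p) : g p \in unitmx by have [] := mulmx1_unit (hg p Dp).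
split=> // i j p Dp; rewrite -(hE i j p Dp).
by rewrite -[h p]mulmx1 -(mulmxV (gU p Dp)) mulmxA hg // mul1mx.
Qed.

Lemma nabla2_eq0 g (T : 'rV[R]_n -> 'M[R]_n) p i j k :
  (forall q, D q -> T q = 0) -> D p -> nabla2 g T p i j k = 0.
Proof.
move=> T0 Dp; rewrite /nabla2.
rewrite (eq_on_partial (G := cst 0) k (jm_open M) _ Dp); last first.
  by move=> q Dq; rewrite T0 // mxE.
rewrite (has_partials_cst 0 p).2 !big1 ?subr0 // => m _; rewrite T0 // mxE mulr0 //.
Qed.

Lemma nabla3_eq0 g (T : 'rV[R]_n -> 'I_n -> 'I_n -> 'I_n -> R) p i j k l :
  (forall q, D q -> forall a b c, T q a b c = 0) -> D p ->
  nabla3 g T p i j k l = 0.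
Proof.
move=> T0 Dp; rewrite /nabla3.
rewrite (eq_on_partial (G := cst 0) l (jm_open M) _ Dp); last first.
  by move=> q Dq; rewrite T0.
by rewrite (has_partials_cst 0 p).2 !big1 ?subr0 // => m _; rewrite T0 // mulr0.
Qed.

End TableTests.

(** * The metrics g_D *)

(** Derivatives of the conformal potential are named by sorted index lists, which makes phi_ij and
    phi_ji the same variable. *)
Fixpoint insert (i : nat) (s : seq nat) : seq nat :=
  if s is j :: s' then if (i <= j)%N then i :: s else j :: insert i s'
  else [:: i].

Lemma insert_split i s :
  exists s1 s2, s = s1 ++ s2 /\ insert i s = s1 ++ i :: s2.
Proof.
elim: s => [|j s [s1 [s2 [-> IH]]]] /=; first by exists [::], [::].
case: ifP => _; first by exists [::], (j :: s1 ++ s2).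
by exists (j :: s1), s2; rewrite IH.
Qed.

(* f_3 is the invertible variable [u1]. *)
Definition jet a b : lpoly :=
  if (a == 0%N) && (b == 1%N) then punit 1 0 else patom (Jet a b).

(** Here [u1] is f_3 and [u2] is e^{2 phi}, with derivative 2 phi_i e^{2 phi}. Directions 0 and 2
    are x^1 and x^3, the only ones on which f depends. *)
Definition der6 (i : nat) : derivation := Derivation
  (if i == 0%N then jet 1 1 else if i == 2%N then jet 0 2 else [::])
  (pmul (pscale (2%BZ, 0%N) (patom (Pot [:: i]))) (punit 0 1))
  (fun v => match v with
   | Crd j => if i == j then pone else [::]
   | Jet a b => if i == 0%N then jet a.+1 b else
                if i == 2%N then jet a b.+1 else [::]
   | Pot s => patom (Pot (insert i s))
   | _ => [::]
   end).

Section PartialsPerm.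
Variables (R : realType) (n : nat) (D : set 'rV[R]_n) (F : 'rV[R]_n -> R).
Hypotheses (Dopen : open D) (sF : smooth_on D F).

Lemma smooth_partials s : smooth_on D (partials s F).
Proof. by move=> t p Dp; have := sF (t ++ s) Dp; rewrite /partials foldr_cat. Qed.

Lemma partial_insert i s t p : D p ->
  partial i (partials (s ++ t) F) p = partials (s ++ i :: t) F p.
Proof.
elim: s p => [//|j s IH] p Dp /=.
rewrite (partial_comm i j Dopen Dp); last exact: smooth_partials.
exact: (eq_on_partial j Dopen IH).
Qed.

End PartialsPerm.

Lemma derive_comp_linear (R : numFieldType) (U V W : normedModType R)
    (A : U -> V) (F : V -> W) v p :
  (forall (h : R) v p, A (h *: v + p) = h *: A v + A p) ->
  'D_v (fun q => F (A q)) p = 'D_(A v) F (A p).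
Proof.
move=> linA; rewrite /derive.
rewrite (_ : (fun h => _) = (fun h : R =>
  h^-1 *: ((F \o shift (A p)) (h *: A v) - F (A p)))) //.
by apply/funext => h /=; rewrite linA.
Qed.

(** * The projection to (x^1, x^3) *)

Section CoordinateProjection.
Variable R : realType.
Implicit Types (p : 'rV[R]_6).

Lemma coord_has_partials n (p : 'rV[R]_n) j :
  has_partials (fun q : 'rV[R]_n => q 0 j) p (fun i => (i == j)%:R).
Proof.
split=> [|i]; first exact: (@differentiable_coord R 1 n p 0 j).
rewrite /partial (@derive_comp_linear R _ _ R^o (fun q : 'rV[R]_n => q 0 j : R^o) id).
  by rewrite derive_id mxE eqxx eq_sym.
by move=> h v q; rewrite !mxE.
Qed.

Lemma pr13E p : pr13 p = p 0 ix1 *: delta_mx 0 ord0 + p 0 ix3 *: delta_mx 0 ord_max.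
Proof.
by apply/rowP => -[[|[|//]] j2]; rewrite !mxE /= ?mulr1 ?mulr0 ?addr0 ?add0r.
Qed.

Lemma pr13_linear (h : R) (v p : 'rV[R]_6) : pr13 (h *: v + p) = h *: pr13 v + pr13 p.
Proof. by apply/rowP => j; rewrite !mxE. Qed.

Lemma pr13_differentiable p : differentiable (@pr13 R) p.
Proof.
rewrite (_ : @pr13 R = fun q => q 0 ix1 *: delta_mx 0 ord0 + q 0 ix3 *: delta_mx 0 ord_max).
  apply: differentiableD; apply: differentiableZl;
    exact: (@differentiable_coord R 1 6).
by apply/funext => q; exact: pr13E.
Qed.

Lemma pr13_has_partials (F : 'rV[R]_2 -> R) p : differentiable F (pr13 p) ->
  has_partials (fun q => F (pr13 q)) p
    (fun i => if i == 0%N :> nat then d1 F (pr13 p)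
              else if i == 2%N :> nat then d3 F (pr13 p) else 0).
Proof.
move=> dF; split=> [|i].
  by apply: differentiable_comp; [exact: pr13_differentiable|].
rewrite /partial (derive_comp_linear F _ _ pr13_linear).
have -> : pr13 (delta_mx 0 i) = if i == 0%N :> nat then delta_mx 0 (Ordinal (isT : 0 < 2)%N)
   else if i == 2%N :> nat then delta_mx 0 (Ordinal (isT : 1 < 2)%N) else 0 :> 'rV[R]_2.
  apply/rowP => -[[|[|//]] j2]; rewrite !mxE /=; rewrite -val_eqE /= eq_sym.
    by case: eqP => [_|_]; rewrite ?mxE //; case: ifP; rewrite !mxE.
  by case: (i : nat) => [|[|[|k]]]; rewrite !mxE.
by case: ifP => _ //; case: ifP => _ //; rewrite derive0.
Qed.

(** A point near the projection of p lifts to a point near p by changing only x^1 and x^3. Openness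
    of the image makes symmetry of second derivatives available for f. *)
Lemma pr13_open (U : set 'rV[R]_6) : open U -> open (@pr13 R @` U).
Proof.
rewrite !openE => Uopen _ [p Up <-].
have /nbhs_ballP[e e0 eU] := Uopen p Up.
apply/nbhs_ballP; exists e => // q [_ qe].
pose p' : 'rV[R]_6 := \row_j if j == ix1 then q 0 ord0
                  else if j == ix3 then q 0 ord_max else p 0 j.
exists p'.
  apply: eU; split=> // i j; rewrite ord1 mxE; case: eqP => [->|_].
    by have := qe 0 ord0; rewrite mxE.
  case: eqP => [->|_]; last exact: ballxx.
  by have := qe 0 ord_max; rewrite mxE.
by apply/rowP => -[[|[|//]] j2]; rewrite !mxE /=; congr (q _ _); apply: val_inj.
Qed.

End CoordinateProjection.


Section Model6.
Variables (R : realType) (U D : set 'rV[R]_6).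
Variables (f : 'rV[R]_2 -> R) (phi : 'rV[R]_6 -> R).
Hypotheses (Uopen : open U) (Dopen : open D) (DU : D `<=` U).
Hypotheses (adm : admissible (pr13 @` U) f) (sphi : smooth_on D phi).

Definition jets (h : 'rV[R]_2 -> R) a b : 'rV[R]_2 -> R :=
  partials (nseq a (@Ordinal 2 0 isT) ++ nseq b (@Ordinal 2 1 isT)) h.

(** The function f is given over U but the potential only on the smaller D, where a local rescaling
    is defined. Taking phi = 0 and D = U gives the metric g_D itself. *)
Definition env6 (p : 'rV[R]_6) : env R :=
  Env (d3 f (pr13 p)) (expR (2 * phi p))
    (fun v => match v with
     | Crd j => oapp (fun k : 'I_6 => p 0 k) 0 (insub j)
     | Jet a b => jets f a b (pr13 p)
     | Pot s => partials [seq inord i | i <- s] phi p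
     | _ => 0
     end).

Lemma ev_jet p a b : ev (env6 p) (jet a b) = jets f a b (pr13 p).
Proof.
rewrite /jet; case: ifP => [/andP[/eqP -> /eqP ->]|_]; last by rewrite ev_atom.
by rewrite ev_unit /= expr1z mulr1.
Qed.

(** The x^1-derivative is already in normal order; the x^3-derivative has to be moved inwards past a
    derivatives in x^1. *)
Lemma jets_has_partials a b p : D p ->
  has_partials (fun q => jets f a b (pr13 q)) p
    (fun i => if i == 0%N :> nat then jets f a.+1 b (pr13 p)
              else if i == 2%N :> nat then jets f a b.+1 (pr13 p) else 0).
Proof.
move=> /DU Up; have fUp : (pr13 @` U) (pr13 p) by exists p.
have fUopen := pr13_open Uopen.
have [dF FE] := pr13_has_partials (adm.1 _ _ fUp : differentiable (jets f a b) _).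
split=> // i; rewrite FE /d3 /jets.
by rewrite (partial_insert fUopen adm.1 _ _ _ fUp).
Qed.

Lemma model6 : jet_model D env6 der6.
Proof.
split=> // [p Dp|p Dp|p Dp|v p Dp].
- have fUp : (pr13 @` U) (pr13 p) by exists p => //; exact: DU.
  by split; [exact: adm.2|rewrite /= gt_eqF // expR_gt0].
- have [dF FE] := jets_has_partials 0 1 Dp; split=> // i; rewrite FE.
  by rewrite /der6 /=; case: ifP => _; [|case: ifP => _]; rewrite ?ev_jet ?ev_nil.
- have dphi : has_partials phi p (fun i => partial i phi p).
    by split=> //; exact: (sphi [::]).
  have h := has_partials_comp (is_derive_expR _)
     (has_partialsM (has_partials_cst 2 p) dphi).
  have [dF FE] := h; split=> // i; rewrite FE.
  rewrite -[der_u2 _]/(pmul (pscale (2%BZ, 0%N) (patom (Pot [:: nat_of_ord i])))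
                         (punit 0 1)).
  rewrite evM ?evZ ?ev_atom ?ev_unit /=; last first.
    split=> /=; last by rewrite gt_eqF // expR_gt0.
    by apply: adm.2; exists p => //; exact: DU.
  rewrite inord_val expr1z /cst mul0r add0r mul1r.
  by rewrite -[evc R _]/(2 / 1 : R) divr1 mulrC.
- case: v => [j|a b|s|i|i].
  + rewrite /=; case: insubP => [k _ <-|].
      have [dF FE] := coord_has_partials p k; split=> // i; rewrite FE /=.
      by rewrite -val_eqE; case: ifP; rewrite ?ev_one ?ev_nil.
    move=> j6; have [dF FE] := has_partials_cst 0 p; split=> // i; rewrite FE /=.
    case: eqP => [ij|_]; last by rewrite ev_nil.
    by move: j6; rewrite -ij ltn_ord.
  + have [dF FE] := jets_has_partials a b Dp; split=> // i; rewrite FE /=.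
    by case: ifP => _; [|case: ifP => _]; rewrite ?ev_jet ?ev_nil.
  + split=> [|i]; first exact: sphi.
    rewrite /= ev_atom /=; have [s1 [s2 [-> ->]]] := insert_split i s.
    by rewrite !map_cat /= (partial_insert Dopen sphi _ _ _ Dp) inord_val.
  + have [dF FE] := has_partials_cst 0 p; split=> // j; rewrite FE /=.
    by rewrite ev_nil.
  + have [dF FE] := has_partials_cst 0 p; split=> // j; rewrite FE /=.
    by rewrite ev_nil.
Qed.

End Model6.

(** * The terms of the obstruction tensor in symbols *)

Section ObstructionTerms.
Variables (n : nat) (d : nat -> derivation).
Notation psumn F := (psum (tab1 n F)).
Implicit Types (gi PU : table2) (G C : table3).

Definition sym_dcotton_term G PU C : table2 :=
  let dC := sym_nabla3 n d G (tab3 n (fun i j k =>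
    pscale const_half (padd (at3 C i j k) (at3 C j i k)))) in
  tab2 n (fun i j => psumn (fun k => psumn (fun l =>
    pmul (at2 PU k l) (at4 dC i j k l)))).

Definition sym_cotton_term1 gi C : table2 :=
  let C1 := tab3 n (fun k i l => psumn (fun a => psumn (fun b =>
    pmul (at3 C a i b) (pmul (at2 gi k a) (at2 gi l b))))) in
  tab2 n (fun i j => psumn (fun k => psumn (fun l =>
    pmul (at3 C1 k i l) (at3 C l j k)))).

Definition sym_cotton_term2 gi C : table2 :=
  let C2 := tab3 n (fun i k l => psumn (fun a => psumn (fun b =>
    pmul (at3 C i a b) (pmul (at2 gi k a) (at2 gi l b))))) in
  tab2 n (fun i j => psumn (fun k => psumn (fun l =>
    pmul (at3 C2 i k l) (at3 C j k l)))).

Variables (R : realType) (D : set 'rV[R]_n) (E : 'rV[R]_n -> env R).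
Hypothesis M : jet_model D E d.
Variables (g : 'rV[R]_n -> 'M[R]_n) (gs gis : table2).
Hypotheses (gE : rep2 D E g gs) (giE : rep2 D E (fun p => invmx (g p)) gis).
Variable C : table3.
Hypothesis CE : rep3 D E (cotton g) C.

Lemma rep_dcotton_term PU : rep2 D E (raise2 g (schouten g)) PU ->
  rep2 D E (obs_schouten_dcotton g)
    (sym_dcotton_term (sym_christoffel n d gs gis) PU C).
Proof.
move=> PUE i j q Dq; have uq := jm_unit M Dq.
rewrite /sym_dcotton_term; set csym := tab3 _ _.
have csymE : rep3 D E (cotton_sym g) csym.
  move=> a b c r Dr; rewrite /cotton_sym at_tab3 evZ evD evc_half.
  by rewrite !(CE _ _ _ Dr).
rewrite mxE at_tab2 ev_sum; apply: eq_bigr => k _; rewrite ev_sum.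
apply: eq_bigr => l _; rewrite evM // (PUE k l _ Dq).
by rewrite (rep_nabla3 M gE giE csymE i j k l Dq).
Qed.

Lemma rep_cotton_term1 :
  rep2 D E (obs_cotton_cotton1 g) (sym_cotton_term1 gis C).
Proof.
move=> i j q Dq; have uq := jm_unit M Dq.
rewrite mxE at_tab2 ev_sum; apply: eq_bigr => k _; rewrite ev_sum.
apply: eq_bigr => l _; rewrite evM // (CE l j k Dq); congr (_ * _).
rewrite at_tab3 ev_sum; apply: eq_bigr => a _; rewrite ev_sum.
apply: eq_bigr => b _; rewrite !evM // (CE a i b Dq) !(giE _ _ Dq).
by rewrite mulrC.
Qed.

Lemma rep_cotton_term2 :
  rep2 D E (obs_cotton_cotton2 g) (sym_cotton_term2 gis C).
Proof.
move=> i j q Dq; have uq := jm_unit M Dq.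
rewrite mxE at_tab2 ev_sum; apply: eq_bigr => k _; rewrite ev_sum.
apply: eq_bigr => l _; rewrite evM // (CE j k l Dq); congr (_ * _).
rewrite at_tab3 ev_sum; apply: eq_bigr => a _; rewrite ev_sum.
apply: eq_bigr => b _; rewrite !evM // (CE i a b Dq) !(giE _ _ Dq).
by rewrite mulrC.
Qed.

Definition sym_trace (gi P : table2) : lpoly :=
  psumn (fun i => at2 (sym_mul n gi P) i i).

Lemma rep_schouten_tr P : rep2 D E (schouten g) P ->
  rep D E (schouten_tr g) (sym_trace gis P).
Proof.
move=> PE q Dq; rewrite ev_sum; apply: eq_bigr => i _.
exact: (rep_mul M giE PE).
Qed.

(** The factor contracted with the Weyl tensor is g^-1 P g^-1 P g^-1, which contains P g^-1 P =
    0. *)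
Lemma obs_weyl_schouten_sq_eq0 p :
  schouten_sq g p = 0 -> obs_weyl_schouten_sq g p = 0.
Proof.
move=> P20; have PP : raise1 g (schouten g) p *m raise2 g (schouten g) p = 0.
  rewrite /raise1 /raise2 !mulmxA -(mulmxA (invmx (g p))) -(mulmxA (invmx (g p))).
  by rewrite -[_ *m _ *m schouten g p]/(schouten_sq g p) P20 mulmx0 mul0mx.
apply/matrixP => i j; rewrite !mxE big1 // => k _; rewrite big1 // => l _.
by have /matrixP/(_ k l) := PP; rewrite !mxE => ->; rewrite mulr0.
Qed.

End ObstructionTerms.

(** * The co-frame, the metric and its inverse in symbols *)

Definition prow : Type := seq lpoly.
Definition at1 (t : prow) i : lpoly := nth [::] t i.

Definition mk_row (l : seq (nat * lpoly)) : prow :=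
  tab1 6 (fun i => psum [seq x.2 | x <- l & x.1 == i]).

Definition const_three_half : coef := (45%BZ, 1%N).
Definition const_neg_half : coef := ((-15)%BZ, 1%N).

Definition sym_theta1 : prow := mk_row [:: (3, pone); (2, patom (Crd 1))]%N.
Definition sym_theta2 : prow := mk_row [:: (4, pone); (0, jet 0 0)]%N.
Definition sym_theta3 : prow := mk_row [:: (5, pone); (1, patom (Crd 0))]%N.
Definition sym_theta4 : prow :=
  mk_row [:: (0%N, pscale const_three_half (punit 2 0))].
Definition sym_theta5 : prow := mk_row
  [:: (1, pscale const_three_half (punit 1 0)); (3, pscale const_neg_half (jet 0 2));
      (2, pscale const_neg_half (pmul (jet 0 2) (patom (Crd 1))))]%N.
Definition sym_theta6 : prow := mk_row
  [:: (2, pscale const_three_half (punit 2 0)); (4, pscale const_half (jet 1 1));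
      (0, pscale const_half (pmul (jet 1 1) (jet 0 0)))]%N.

Definition sym_sprod (a b : prow) i j : lpoly :=
  padd (pmul (at1 a i) (at1 b j)) (pmul (at1 b i) (at1 a j)).

Definition sym_g : table2 := tab2 6 (fun i j =>
  padd (padd (sym_sprod sym_theta1 sym_theta4 i j)
             (sym_sprod sym_theta2 sym_theta5 i j))
       (sym_sprod sym_theta3 sym_theta6 i j)).

(* The coordinate differentials in the basis theta^1, ..., theta^6. *)
Definition sym_dx1 : prow :=
  mk_row [:: (3%N, pscale (20%BZ, 1%N) (punit (-2) 0))].
Definition sym_dx2 : prow := mk_row
  [:: (4, pscale (20%BZ, 1) (punit (-1) 0));
      (0, pscale (10%BZ, 1) (pmul (punit (-1) 0) (jet 0 2)))]%N.
Definition sym_dx3 : prow := mk_row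
  [:: (5, pscale (20%BZ, 1) (punit (-2) 0));
      (1, pscale ((-10)%BZ, 1) (pmul (punit (-2) 0) (jet 1 1)))]%N.
Definition sym_dy (i : nat) (a : lpoly) (b : prow) : prow := tab1 6 (fun j =>
  psub (if i == j then pone else [::]) (pmul a (at1 b j))).
Definition sym_dual : table2 :=
  [:: sym_dx1; sym_dx2; sym_dx3; sym_dy 0 (patom (Crd 1)) sym_dx3;
      sym_dy 1 (jet 0 0) sym_dx1; sym_dy 2 (patom (Crd 0)) sym_dx2].

(* The metric pairs theta^k with theta^(k+3). *)
Definition sym_ginv : table2 := tab2 6 (fun i j =>
  psum (tab1 6 (fun k => pmul (at2 sym_dual i k)
    (at2 sym_dual j (if k < 3 then k + 3 else k - 3)%N)))).

Definition sym_G : table3 := sym_christoffel 6 der6 sym_g sym_ginv.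
Definition sym_Ric : table2 := sym_ricci 6 der6 sym_G.
(** The scalar curvature is entered as the zero polynomial; [scal_gD] justifies this, the Ricci
    tensor being represented without reference to it. *)
Definition sym_P : table2 := sym_schouten 6 sym_g sym_Ric [::].
Definition sym_W : table4 :=
  sym_weyl 6 sym_g (sym_riemann 6 sym_g (sym_riemann_up 6 der6 sym_G)) sym_P.
Definition sym_C : table3 := sym_cotton 6 der6 sym_G sym_P.
Definition sym_PU : table2 := sym_mul 6 (sym_mul 6 sym_ginv sym_P) sym_ginv.
Definition sym_B : table2 := sym_bach 6 sym_ginv
  (sym_nabla3 6 der6 sym_G sym_C) sym_PU sym_W.
Definition sym_P2 : table2 := sym_mul 6 (sym_mul 6 sym_P sym_ginv) sym_P.

Definition sym_PdC : table2 := sym_dcotton_term 6 der6 sym_G sym_PU sym_C.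
Definition sym_CC1 : table2 := sym_cotton_term1 6 sym_ginv sym_C.
Definition sym_CC2 : table2 := sym_cotton_term2 6 sym_ginv sym_C.
Definition sym_trP : lpoly := sym_trace 6 sym_ginv sym_P.

(** Closed statements about lists of integers, valid for all f at once. The terms absent here follow
    from others: those with the Bach tensor from B = 0, the one with P^k_m P^{ml} from P^2 = 0, the
    one with the gradient of the trace from the vanishing trace. *)
Lemma computed_tensors :
  [/\ eq_table2 6 (sym_mul 6 sym_ginv sym_g) (id_table 6),
      nilp (sym_scal 6 sym_ginv sym_Ric), nilp sym_trP,
      eq_table2 6 sym_P2 [::] & eq_table2 6 sym_B [::]] /\
  [/\ eq_table2 6 sym_PdC [::], eq_table2 6 sym_CC1 [::]
    & eq_table2 6 sym_CC2 [::]].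
Proof.
have conjP (a b c d e a' b' c' : bool) :
    [&& a, b, c, d & e] && [&& a', b' & c'] ->
    [/\ a, b, c, d & e] /\ [/\ a', b' & c'].
  by case/andP => /and5P[? ? ? ? ?] /and3P[? ? ?].
by apply: conjP; vm_compute.
Qed.

(** * Curvature identities of g_D *)

Section GD.
Variables (R : realType) (U D : set 'rV[R]_6).
Variables (f : 'rV[R]_2 -> R) (phi : 'rV[R]_6 -> R).
Hypotheses (Uopen : open U) (Dopen : open D) (DU : D `<=` U).
Hypotheses (adm : admissible (pr13 @` U) f) (sphi : smooth_on D phi).

Let E := env6 f phi.
Let M : jet_model D E der6 := model6 Uopen Dopen DU adm sphi.

Lemma ev_mk_row_nil e (i : 'I_6) : ev e (at1 (mk_row [::]) i) = 0 :> R.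
Proof. by rewrite /at1 nth_tab1 // ev_nil. Qed.

Lemma ev_mk_row_cons e k P l (i : 'I_6) :
  ev e (at1 (mk_row ((k, P) :: l)) i) =
  (k == i)%:R * ev e P + ev e (at1 (mk_row l) i) :> R.
Proof.
rewrite /at1 !nth_tab1 //=; case: eqP => _; last by rewrite mul0r add0r.
by rewrite mul1r evD.
Qed.

Let ev_mk_row := (ev_mk_row_cons, ev_mk_row_nil).

Lemma dcE (k i : 'I_6) : (dc k : 'rV[R]_6) 0 i = ((k : nat) == i)%:R.
Proof. by rewrite mxE eqxx -val_eqE eq_sym. Qed.

Let rowD (a b : 'rV[R]_6) (i : 'I_6) : (a + b) 0 i = a 0 i + b 0 i.
Proof. by rewrite mxE. Qed.
Let rowN (a : 'rV[R]_6) (i : 'I_6) : (- a) 0 i = - a 0 i.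
Proof. by rewrite mxE. Qed.
Let rowZ c (a : 'rV[R]_6) (i : 'I_6) : (c *: a) 0 i = c * a 0 i.
Proof. by rewrite mxE. Qed.
Let rowE := (rowD, rowN, rowZ, dcE).

Lemma env6_coord p (j : 'I_6) : ev (E p) (patom (Crd j)) = p 0 j.
Proof. by rewrite ev_atom /= (valK j). Qed.

Lemma evc_three_half : evc R const_three_half = 3 / 2.
Proof. by rewrite -[evc R _]/(45%:R / 30 ^+ 1 : R); field. Qed.

Lemma evc_half_opp : evc R const_neg_half = - (1 / 2).
Proof. by rewrite -[evc R _]/((- 15%:Z)%:~R / 30 ^+ 1 : R); field. Qed.

Definition rep1 (T : 'rV[R]_6 -> 'rV[R]_6) (t : prow) :=
  forall p, D p -> forall i : 'I_6, T p 0 i = ev (E p) (at1 t i).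

Let f2E p : ev (E p) (punit 1 0) = d3 f (pr13 p).
Proof. by rewrite ev_unit /= expr1z mulr1. Qed.

Lemma rep_theta1 : rep1 (@theta1 R) sym_theta1.
Proof.
move=> p Dp i; rewrite /sym_theta1 !ev_mk_row ev_one (env6_coord p ix2).
rewrite /theta1 !rowE. by ring.
Qed.

Lemma rep_theta2 : rep1 (theta2 f) sym_theta2.
Proof.
move=> p Dp i; rewrite /sym_theta2 !ev_mk_row ev_one ev_jet.
rewrite /theta2 !rowE /jets /=. by ring.
Qed.

Lemma rep_theta3 : rep1 (@theta3 R) sym_theta3.
Proof.
move=> p Dp i; rewrite /sym_theta3 !ev_mk_row ev_one (env6_coord p ix1).
rewrite /theta3 !rowE. by ring.
Qed.

Lemma rep_theta4 : rep1 (theta4 f) sym_theta4.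
Proof.
move=> p Dp i; rewrite /sym_theta4 !ev_mk_row evZ evc_three_half.
rewrite ev_unit /theta4 !rowE /=. by ring.
Qed.

Lemma rep_theta5 : rep1 (theta5 f) sym_theta5.
Proof.
move=> p Dp i; have up := jm_unit M Dp.
rewrite /sym_theta5 !ev_mk_row !evZ evc_three_half evc_half_opp evM // ev_jet.
rewrite f2E (env6_coord p ix2) /theta5 /theta1.
rewrite !rowE /jets /d3 /d1 /=.
by ring.
Qed.

Lemma rep_theta6 : rep1 (theta6 f) sym_theta6.
Proof.
move=> p Dp i; have up := jm_unit M Dp.
rewrite /sym_theta6 !ev_mk_row !evZ evc_three_half evc_half evM // !ev_jet.
rewrite ev_unit /theta6 /theta2.
have fUp : (pr13 @` U) (pr13 p) by exists p => //; exact: DU.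
(* The form [theta6] contains d_3 d_1 f, whereas [jet 1 1] stands for d_1 d_3 f. *)
have c13 := partial_comm (Ordinal (isT : 1 < 2)%N) (Ordinal (isT : 0 < 2)%N)
  (pr13_open Uopen) fUp adm.1.
by rewrite !rowE /jets /d3 /d1 /= c13 /d3; field.
Qed.

Lemma rep_sprod a b s t i j p : D p -> rep1 a s -> rep1 b t ->
  (2 *: sprod (a p) (b p)) i j = ev (E p) (sym_sprod s t i j).
Proof.
move=> Dp aE bE; rewrite evD !evM; try exact: (jm_unit M Dp).
by rewrite -!aE // -!bE // /sprod !mxE !big_ord1 !mxE; field.
Qed.

Lemma rep_gD : rep2 D E (gD f) sym_g.
Proof.
move=> i j p Dp; rewrite at_tab2 2!evD /gD 2!mxE.
rewrite (rep_sprod i j Dp rep_theta1 rep_theta4).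
rewrite (rep_sprod i j Dp rep_theta2 rep_theta5).
by rewrite (rep_sprod i j Dp rep_theta3 rep_theta6).
Qed.


Lemma rep_gD_inv : rep2 D E (fun p => invmx (gD f p)) sym_ginv.
Proof.
have [[ginvg _ _ _ _] _] := computed_tensors.
by have [] := rep_invmx M rep_gD ginvg.
Qed.

Lemma trmx_sprod n (a b : 'rV[R]_n) : (sprod a b)^T = sprod a b.
Proof. by rewrite /sprod linearZ linearD /= !trmx_mul !trmxK addrC. Qed.

Lemma gD_sym p : (gD f p)^T = gD f p.
Proof.
have symZ (a b : 'rV[R]_6) : (2 *: sprod a b)^T = 2 *: sprod a b.
  by rewrite linearZ /= trmx_sprod.
by rewrite /gD raddfD /= raddfD /= !symZ.
Qed.

Lemma rep_ricci_gD : rep2 D E (ricci (gD f)) sym_Ric.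
Proof. exact: (rep_ricci M rep_gD rep_gD_inv). Qed.

Lemma scal_gD p : D p -> scal (gD f) p = 0.
Proof.
move=> Dp; have [[_ /nilP scal0 _ _ _] _] := computed_tensors.
by rewrite (rep_scal M rep_gD_inv rep_ricci_gD Dp) scal0 ev_nil.
Qed.

Lemma rep_schouten_gD : rep2 D E (schouten (gD f)) sym_P.
Proof.
apply: (rep_schouten M rep_gD rep_ricci_gD) => p Dp.
by rewrite scal_gD // ev_nil.
Qed.

Let repC : rep3 D E (cotton (gD f)) sym_C :=
  rep_cotton M rep_gD rep_gD_inv rep_schouten_gD.

Lemma rep_weyl_gD : rep4 D E (weyl (gD f)) sym_W.
Proof.
apply: (rep_weyl M rep_gD _ rep_schouten_gD).
by apply: (rep_riemann M rep_gD); exact: (rep_riemann_up M rep_gD rep_gD_inv).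
Qed.

Let repPU : rep2 D E (raise2 (gD f) (schouten (gD f))) sym_PU :=
  rep_mul M (rep_mul M rep_gD_inv rep_schouten_gD) rep_gD_inv.

Lemma bach_gD p : D p -> bach (gD f) p = 0.
Proof.
move=> Dp; have [[_ _ _ _ B0] _] := computed_tensors.
apply: (rep2_eq0 _ B0 Dp).
exact: (rep_bach M rep_gD_inv repC (rep_nabla3 M rep_gD rep_gD_inv repC) repPU
  rep_weyl_gD rep_schouten_gD).
Qed.

Lemma schouten_sq_gD p : D p -> schouten_sq (gD f) p = 0.
Proof.
move=> Dp; have [[_ _ _ P20 _] _] := computed_tensors.
apply: (rep2_eq0 _ P20 Dp).
exact: (rep_mul M (rep_mul M rep_schouten_gD rep_gD_inv) rep_schouten_gD).
Qed.

(** The Bach tensor vanishes on the whole open set D, so its first and second covariant derivatives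
    vanish there as well. *)
Lemma obs_lapl_bach_gD p : D p -> obs_lapl_bach (gD f) p = 0.
Proof.
move=> Dp; apply/matrixP => i j; rewrite !mxE big1 // => k _.
rewrite big1 // => l _; rewrite (nabla3_eq0 M) ?mulr0 // => q Dq a b c.
by apply: (nabla2_eq0 M) => // r Dr; exact: bach_gD.
Qed.

Lemma obs_weyl_bach_gD p : D p -> obs_weyl_bach (gD f) p = 0.
Proof.
move=> Dp; apply/matrixP => i j; rewrite !mxE big1 // => k _.
by rewrite big1 // => l _; rewrite /raise2 bach_gD // mulmx0 mul0mx mxE mulr0.
Qed.

Lemma obs_tr_bach_gD p : D p -> obs_tr_bach (gD f) p = 0.
Proof. by move=> Dp; rewrite /obs_tr_bach bach_gD // scaler0. Qed.

Lemma obs_schouten_dcotton_gD p : D p -> obs_schouten_dcotton (gD f) p = 0.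
Proof.
move=> Dp; have [_ [t0 _ _]] := computed_tensors.
exact: (rep2_eq0 (rep_dcotton_term M rep_gD rep_gD_inv repC repPU) t0 Dp).
Qed.

Lemma obs_cotton_cotton1_gD p : D p -> obs_cotton_cotton1 (gD f) p = 0.
Proof.
move=> Dp; have [_ [_ t0 _]] := computed_tensors.
exact: (rep2_eq0 (rep_cotton_term1 M rep_gD_inv repC) t0 Dp).
Qed.

Lemma obs_cotton_cotton2_gD p : D p -> obs_cotton_cotton2 (gD f) p = 0.
Proof.
move=> Dp; have [_ [_ _ t0]] := computed_tensors.
exact: (rep2_eq0 (rep_cotton_term2 M rep_gD_inv repC) t0 Dp).
Qed.

Lemma schouten_tr_gD p : D p -> schouten_tr (gD f) p = 0.
Proof.
move=> Dp; have [[_ _ /nilP t0 _ _] _] := computed_tensors.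
by rewrite (rep_schouten_tr M rep_gD_inv rep_schouten_gD Dp) [sym_trace _ _ _]t0 ev_nil.
Qed.

Lemma obs_cotton_dtr_gD p : D p -> obs_cotton_dtr (gD f) p = 0.
Proof.
move=> Dp; apply/matrixP => i j; rewrite !mxE big1 // => l _.
rewrite (eq_on_partial (G := cst 0) l Dopen _ Dp).
  by rewrite (has_partials_cst 0 p).2 mulr0.
by move=> q Dq; rewrite schouten_tr_gD.
Qed.

Lemma obs_weyl_schouten_sq_gD p : D p -> obs_weyl_schouten_sq (gD f) p = 0.
Proof. by move=> Dp; rewrite obs_weyl_schouten_sq_eq0 // schouten_sq_gD. Qed.

End GD.

(** * Conformal rescalings *)

Section EinsteinCotton.
Variables (R : realType) (n : nat) (D : set 'rV[R]_n) (g : 'rV[R]_n -> 'M[R]_n).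
Hypotheses (Dopen : open D) (gm : metric_on D g).

Let gT p i j : D p -> g p i j = g p j i.
Proof. by case: gm => _ + _ Dp => /(_ p Dp)/matrixP/(_ j i) <-; rewrite mxE. Qed.

(** These are the Christoffel symbols of the first kind; adding the two that occur in the covariant
    derivative of g leaves exactly the partial derivative of g_ij. *)
Lemma lower_christoffel p i j k : D p ->
  \sum_m christoffel g p m i j * g p m k =
  2^-1 * (partial i (fun q => g q j k) p + partial j (fun q => g q i k) p
          - partial k (fun q => g q i j) p).
Proof.
move=> Dp; case: gm => _ _ /(_ p Dp) gU.
pose X l := partial i (fun q => g q j l) p + partial j (fun q => g q i l) p
          - partial l (fun q => g q i j) p.
have -> : \sum_m christoffel g p m i j * g p m k =
    \sum_l 2^-1 * X l * (g p *m invmx (g p)) k l.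
  under eq_bigr => m _ do rewrite /christoffel -/(X _) -mulrA mulr_suml mulr_sumr.
  rewrite exchange_big /=; apply: eq_bigr => l _; rewrite mxE mulr_sumr.
  by apply: eq_bigr => m _; rewrite /X (gT m k Dp); ring.
rewrite mulmxV // (bigD1 k) //= mxE eqxx mulr1 big1 ?addr0 // => l lk.
by rewrite mxE eq_sym (negbTE lk) mulr0.
Qed.

Lemma nabla2_metric p i j k : D p -> nabla2 g g p i j k = 0.
Proof.
move=> Dp; rewrite /nabla2 lower_christoffel //.
under [X in _ - _ - X]eq_bigr => m _ do rewrite (gT i m Dp).
rewrite lower_christoffel //.
have gTd a b c : partial c (fun q => g q a b) p = partial c (fun q => g q b a) p.
  by apply: (eq_on_partial c Dopen _ Dp) => q Dq; exact: gT.
by rewrite (gTd j i k); field.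
Qed.

(** If Ric = lam g, then the scalar curvature is n lam and the Schouten tensor is a constant
    multiple of the parallel tensor g. This reduces the Einstein half of (i) to the Cotton half. *)
Lemma einstein_cotton_flat : einstein_on D g -> cotton_flat_on D g.
Proof.
move=> [lam ricE]; case: (gm) => gs _ gU.
pose c := (n%:R - 2)^-1 * (lam - lam * n%:R / (2 * (n%:R - 1))).
have scalE p : D p -> scal g p = lam * n%:R.
  move=> Dp; have -> : lam * n%:R = lam * \tr (1%:M : 'M[R]_n) by rewrite mxtrace1.
  rewrite -(mulVmx (gU p Dp)) /mxtrace mulr_sumr; apply: eq_bigr => i _.
  rewrite mxE mulr_sumr; apply: eq_bigr => j _.
  by rewrite ricE // mxE mulrCA (gT i j Dp).
have PE p : D p -> schouten g p = c *: g p.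
  by move=> Dp; rewrite /schouten scalE // ricE // -scalerBl scalerA.
have nP p i j k : D p -> nabla2 g (schouten g) p i j k = 0.
  move=> Dp; transitivity (c * nabla2 g g p i j k); last first.
    by rewrite nabla2_metric // mulr0.
  rewrite /nabla2 !mulrBr !mulr_sumr; congr (_ - _ - _).
  - have dg : has_partials (fun q => g q i j) p (fun l => partial l (fun q => g q i j) p).
      by split=> //; exact: (gs i j [::]).
    have [_ dcg] := has_partialsM (has_partials_cst c p) dg.
    have <- := eq_on_partial (F := fun q => cst c q * g q i j) k Dopen _ Dp; last first.
      by move=> q Dq; rewrite PE // mxE.
    by rewrite dcg mul0r add0r.
  - by apply: eq_bigr => m _; rewrite PE // mxE mulrCA.
  - by apply: eq_bigr => m _; rewrite PE // mxE mulrCA.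
by move=> p Dp i j k; rewrite /cotton !nP // subrr.
Qed.

End EinsteinCotton.

Definition sym_gh : table2 :=
  tab2 6 (fun i j => pmul (punit 0 1) (at2 sym_g i j)).
Definition sym_ghinv : table2 :=
  tab2 6 (fun i j => pmul (punit 0 (-1)) (at2 sym_ginv i j)).
Definition sym_Gh : table3 := sym_christoffel 6 der6 sym_gh sym_ghinv.
Definition sym_Rich : table2 := sym_ricci 6 der6 sym_Gh.
Definition sym_Ph : table2 :=
  sym_schouten 6 sym_gh sym_Rich (sym_scal 6 sym_ghinv sym_Rich).

Definition sym_C424 : lpoly := at3 sym_C 4 2 4.

(* A conformal change adds W(grad phi, -, -, -) to the Cotton tensor; the
   component below is not affected since W_{l424} = 0 for all l. *)
Lemma computed_conformal : eq_table2 6 (sym_mul 6 sym_ghinv sym_gh) (id_table 6) /\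
  peqb (sym_cotton_entry 6 der6 sym_Gh sym_Ph 4 2 4) sym_C424.
Proof. by apply/andP; vm_compute. Qed.

Section Conformal.
Variables (R : realType) (U D : set 'rV[R]_6).
Variables (f : 'rV[R]_2 -> R) (phi : 'rV[R]_6 -> R).
Hypotheses (Uopen : open U) (Dopen : open D) (DU : D `<=` U).
Hypotheses (adm : admissible (pr13 @` U) f) (sphi : smooth_on D phi).

Let E := env6 f phi.
Let M : jet_model D E der6 := model6 Uopen Dopen DU adm sphi.
Let gh := conf_rescale phi (gD f).

Lemma rep_conf : rep2 D E gh sym_gh.
Proof.
move=> i j p Dp; rewrite at_tab2 evM; last exact: (jm_unit M Dp).
rewrite -(rep_gD Uopen Dopen DU adm sphi i j Dp) ev_unit /= expr1z mul1r.
by rewrite /gh /conf_rescale mxE.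
Qed.

Lemma rep_conf_inv : rep2 D E (fun p => invmx (gh p)) sym_ghinv.
Proof. by have [id6 _] := computed_conformal; have [] := rep_invmx M rep_conf id6. Qed.

Lemma metric_conf : metric_on D gh.
Proof.
split=> [i j|p Dp|p Dp].
- exact: (rep_smooth M (rep_conf i j)).
- by rewrite /gh /conf_rescale linearZ /= gD_sym.
- by have [id6 _] := computed_conformal; have [_] := rep_invmx M rep_conf id6; apply.
Qed.

Lemma rep_schouten_conf : rep2 D E (schouten gh) sym_Ph.
Proof.
have rE := rep_ricci M rep_conf rep_conf_inv.
exact: (rep_schouten M rep_conf rE (rep_scal M rep_conf_inv rE)).
Qed.

Lemma cotton_conf p : D p -> cotton gh p iy2 ix3 iy2 = ev (E p) sym_C424.
Proof.
move=> Dp; have [_ h424] := computed_conformal.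
rewrite (rep_cotton_entry M rep_conf rep_conf_inv iy2 ix3 iy2 rep_schouten_conf Dp).
exact: peqbP h424.
Qed.

End Conformal.

(** * The ambient metric *)

(* In the ambient space u2 is t and [Crd 7] is rho. *)
Definition der8 (i : nat) : derivation :=
  if i == 0%N then Derivation [::] pone (fun=> [::]) else
  if i == 7%N then Derivation [::] [::]
    (fun v => if v is Crd 7 then pone else [::])
  else Derivation (der_u1 (der6 i.-1)) [::]
    (fun v => match v with
     | Crd 7 => [::]
     | Crd _ | Jet _ _ => der_atom (der6 i.-1) v
     | _ => [::]
     end).

Definition two_rho : lpoly := pscale (2%BZ, 0%N) (patom (Crd 7)).

(** Index 0 is t, 7 is rho and 1 to 6 are the x-directions. The corner entries come from 2 dt d(rho
    t) = 2 rho dt^2 + 2 t dt drho. *)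
Definition amb_table (g P : table2) : table2 := tab2 8 (fun i j =>
  if i == 0%N then
    if j == 0%N then two_rho else if j == 7%N then punit 0 1 else [::]
  else if i == 7%N then if j == 0%N then punit 0 1 else [::]
  else if (j == 0%N) || (j == 7%N) then [::]
  else pmul (punit 0 2)
    (padd (at2 g i.-1 j.-1) (pmul two_rho (at2 P i.-1 j.-1)))).

(* Since P^2 = 0, the inverse of g + 2 rho P is g^-1 - 2 rho g^-1 P g^-1. *)
Definition amb_inv_table (gi PU : table2) : table2 := tab2 8 (fun i j =>
  if i == 0%N then if j == 7%N then punit 0 (-1) else [::]
  else if i == 7%N then
    if j == 0%N then punit 0 (-1) else
    if j == 7%N then pmul (pscale ((-1)%BZ, 0%N) two_rho) (punit 0 (-2))
    else [::]
  else if (j == 0%N) || (j == 7%N) then [::]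
  else pmul (punit 0 (-2))
    (psub (at2 gi i.-1 j.-1) (pmul two_rho (at2 PU i.-1 j.-1)))).

Definition sym_amb : table2 := amb_table sym_g sym_P.
Definition sym_amb_inv : table2 := amb_inv_table sym_ginv sym_PU.

Definition x_atom (v : atom) : bool :=
  match v with Crd 7 => false | Crd _ | Jet _ _ => true | _ => false end.

(** Polynomials free of t and rho: their value at an ambient point q is their value at the base
    point [amb_x q]. *)
Definition x_poly : lpoly -> bool := only_atoms x_atom.

Definition x_table (t : table2) : bool := all (all x_poly) t.

(** Here rho is a variable, so invertibility and Ricci-flatness hold for all values of rho and not
    just near rho = 0. *)
Lemma computed_ambient :
  [/\ eq_table2 8 (sym_mul 8 sym_amb_inv sym_amb) (id_table 8),
      eq_table2 8 sym_amb (tab2 8 (fun i j => at2 sym_amb j i)),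
      eq_table2 8 (sym_ricci 8 der8 (sym_christoffel 8 der8 sym_amb sym_amb_inv))
        [::], x_table sym_g & x_table sym_P].
Proof. by apply/and5P; vm_compute. Qed.

Lemma eq_table2_tr (R : realType) n (e : env R) t :
  eq_table2 n t (tab2 n (fun i j => at2 t j i)) ->
  forall i j : 'I_n, ev e (at2 t j i) = ev e (at2 t i j).
Proof. by move=> tE i j; rewrite [RHS](eq_table2P _ tE) at_tab2. Qed.

(** * Coordinates on the ambient space *)

Section AmbientCoordinates.
Variable R : realType.
Implicit Types q : 'rV[R]_(1 + 6 + 1).

Lemma amb_tE q : amb_t q = q 0 (lshift 1 (lshift 6 ord0)).
Proof. by rewrite /amb_t !mxE. Qed.

Lemma amb_rhoE q : amb_rho q = q 0 (rshift (1 + 6) ord0).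
Proof. by rewrite /amb_rho !mxE. Qed.

Lemma amb_xE q k : amb_x q 0 k = q 0 (lshift 1 (rshift 1 k)).
Proof. by rewrite /amb_x !mxE. Qed.

Lemma amb_x_linear (h : R) q q' : amb_x (h *: q + q') = h *: amb_x q + amb_x q'.
Proof. by rewrite /amb_x !linearP. Qed.

Lemma amb_x_differentiable q : differentiable (@amb_x R 6) q.
Proof.
exact: (differentiable_comp (differentiable_lsubmx q)
  (differentiable_rsubmx (lsubmx q : 'rV[R]_(1 + 6)))).
Qed.

Lemma amb_t_has_partials q :
  has_partials (@amb_t R 6) q (fun i => (i == 0%N :> nat)%:R).
Proof.
rewrite (_ : @amb_t R 6 = fun q => q 0 (lshift 1 (lshift 6 ord0))).
  exact: coord_has_partials.
by apply/funext => r; exact: amb_tE.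
Qed.

Lemma amb_rho_has_partials q :
  has_partials (@amb_rho R 6) q (fun i => (i == 7%N :> nat)%:R).
Proof.
rewrite (_ : @amb_rho R 6 = fun q => q 0 (rshift (1 + 6) ord0)).
  exact: coord_has_partials.
by apply/funext => r; exact: amb_rhoE.
Qed.

Lemma amb_x_has_partials (F : 'rV[R]_6 -> R) dF q :
  has_partials F (amb_x q) (fun i => dF (nat_of_ord i)) ->
  has_partials (fun r => F (amb_x r)) q
    (fun i => if (i == 0%N :> nat) || (i == 7%N :> nat) then 0 else dF i.-1).
Proof.
move=> [dFx FE]; split=> [|i].
  by apply: differentiable_comp; [exact: amb_x_differentiable|].
rewrite /partial (derive_comp_linear F _ _ amb_x_linear).
have dx0 : (i == 0%N :> nat) || (i == 7%N :> nat) ->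
    amb_x (delta_mx 0 i : 'rV[R]_(1 + 6 + 1)) = 0.
  move=> i07; apply/rowP => k; rewrite amb_xE !mxE eqxx /= -val_eqE /=.
  by have := ltn_ord k; case/orP: i07 => /eqP -> k6; case: eqP => // /eqP; lia.
case: ifP => [/dx0 ->|/negbT]; first by rewrite derive0.
rewrite negb_or => /andP[i0 i7].
have i6 : (i.-1 < 6)%N by have := ltn_ord i; lia.
have -> : amb_x (delta_mx 0 i : 'rV[R]_(1 + 6 + 1)) = delta_mx 0 (Ordinal i6).
  apply/rowP => k; rewrite amb_xE !mxE !eqxx /= -!val_eqE /=; congr (_%:R).
  by apply/eqP/eqP; lia.
exact: FE.
Qed.

Lemma amb_domain_open (U : set 'rV[R]_6) : open U -> open (amb_domain U).
Proof.
move=> Uopen; rewrite (_ : amb_domain U =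
  (@amb_t R 6 @^-1` [set t | 0 < t]) `&` (@amb_x R 6 @^-1` U)) //.
apply: openI; apply: open_comp => //.
- by move=> q _; apply/differentiable_continuous/(amb_t_has_partials q).1.
- by move=> q _; apply/differentiable_continuous/amb_x_differentiable.
Qed.

Lemma amb_index (i : 'I_(1 + 6 + 1)) :
  [\/ i = 0%N :> nat, i = 7%N :> nat | exists k, i = lshift 1 (rshift 1 k)].
Proof.
case: (split_ordP i) => [j ->|j ->]; last by constructor 2; rewrite ord1.
case: (split_ordP j) => [k ->|k ->]; last by constructor 3; exists k.
by constructor 1; rewrite ord1.
Qed.

Lemma amb_pull_x (h : 'M[R]_6) k l :
  amb_pull h (lshift 1 (rshift 1 k)) (lshift 1 (rshift 1 l)) = h k l.
Proof. by rewrite /amb_pull block_mxEul block_mxEdr. Qed.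

Lemma amb_pull_0l (h : 'M[R]_6) (i j : 'I_(1 + 6 + 1)) :
  (i == 0%N :> nat) || (i == 7%N :> nat) -> amb_pull h i j = 0.
Proof.
rewrite /amb_pull => i07; case: (split_ordP i) i07 => [i' ->|i' -> _]; last first.
  by case: (split_ordP j) => j' ->; rewrite ?block_mxEdl ?block_mxEdr mxE.
case: (split_ordP i') => [i'' -> _|i'' ->]; last first.
  by move=> i07; exfalso; have := ltn_ord i''; move: i07 => /=; lia.
case: (split_ordP j) => j' ->; rewrite ?block_mxEul ?block_mxEur; last by rewrite mxE.
by case: (split_ordP j') => j'' ->; rewrite ?block_mxEul ?block_mxEur mxE.
Qed.

Lemma amb_pull_tr (h : 'M[R]_6) : (amb_pull h)^T = amb_pull h^T.
Proof. by rewrite /amb_pull !tr_block_mx !trmx0. Qed.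

Lemma amb_pull_0r (h : 'M[R]_6) (i j : 'I_(1 + 6 + 1)) :
  (j == 0%N :> nat) || (j == 7%N :> nat) -> amb_pull h i j = 0.
Proof.
move=> j07; rewrite -[h]trmxK -amb_pull_tr [LHS]mxE.
exact: amb_pull_0l.
Qed.

End AmbientCoordinates.

Lemma smooth_cst0 (R : realType) n (D : set 'rV[R]_n) :
  smooth_on D (cst 0 : 'rV[R]_n -> R).
Proof.
have d0 s : partials s (cst 0 : 'rV[R]_n -> R) = cst 0.
  by elim: s => //= i s ->; apply/funext => p; exact: (has_partials_cst 0 p).2.
by move=> s p _; rewrite d0; exact: (has_partials_cst 0 p).1.
Qed.

(** * The ambient space as a model, and Ricci-flatness *)

Section Ambient.
Variables (R : realType) (U : set 'rV[R]_6) (f : 'rV[R]_2 -> R).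
Hypotheses (Uopen : open U) (adm : admissible (pr13 @` U) f).

Let E6 := env6 f (cst 0).
Let s0 : smooth_on U (cst 0 : _ -> R) := @smooth_cst0 R 6 U.

Let M6 : jet_model U E6 der6 := model6 Uopen Uopen (@subset_refl _ U) adm s0.

Definition env8 (q : 'rV[R]_(1 + 6 + 1)) : env R :=
  Env (d3 f (pr13 (amb_x q))) (amb_t q)
    (fun v => match v with
     | Crd 7 => amb_rho q
     | Crd _ | Jet _ _ => env_atom (E6 (amb_x q)) v
     | _ => 0
     end).

Lemma ev_x_poly q P : x_poly P -> ev (env8 q) P = ev (E6 (amb_x q)) P.
Proof.
move=> xP; apply: (eq_ev xP) => // v; case: v => [j|a b|s|i|i] //.
by do 8?[case: j => // j].
Qed.

Lemma model8 : jet_model (amb_domain U) env8 der8.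
Proof.
split=> [|q [t0 Ux]|q [t0 Ux]|q [t0 Ux]|v q [t0 Ux]].
- exact: amb_domain_open.
- by split; [exact: (jm_unit M6 Ux).1|rewrite /= gt_eqF].
- apply: (eq_has_partials (amb_domain_open Uopen) _ (conj t0 Ux) _
    (@amb_x_has_partials _ _ (fun k => ev (E6 (amb_x q)) (der_u1 (der6 k))) q
       (jm_u1 M6 Ux))) => // i.
  rewrite /der8; have [/orP[/eqP -> | /eqP ->]|] := boolP (_ || _);
    rewrite ?ev_nil //.
  rewrite negb_or => /andP[/negbTE -> /negbTE ->].
  have xu1 : x_poly (der_u1 (der6 i.-1)).
    by rewrite /der6 /=; case: ifP => // _; case: ifP.
  by rewrite -[der_u1 _]/(der_u1 (der6 i.-1)) ev_x_poly.
- have [dF FE] := amb_t_has_partials q; split=> // i; rewrite FE /der8.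
  case: eqP => [_|_]; first by rewrite ev_one.
  by case: ifP; rewrite ev_nil.
- have atom0 (w : atom) : (forall i, der_atom (der8 i) w = [::]) ->
      (forall r, env_atom (env8 r) w = 0) ->
      has_partials (fun r => env_atom (env8 r) w) q
        (fun i => ev (env8 q) (der_atom (der8 i) w)).
    move=> dw w0; have [dF FE] := has_partials_cst 0 q.
    rewrite (_ : (fun r => _) = cst 0); last by apply/funext => r; exact: w0.
    by split=> // i; rewrite FE dw ev_nil.
  have atom_x (w : atom) : (forall r, env_atom (env8 r) w = env_atom (E6 (amb_x r)) w) ->
      (forall i, (i == 0%N) || (i == 7%N) -> der_atom (der8 i) w = [::]) ->
      (forall i, ~~ ((i == 0%N) || (i == 7%N)) ->
         der_atom (der8 i) w = der_atom (der6 i.-1) w) ->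
      (forall i, x_poly (der_atom (der6 i) w)) ->
      has_partials (fun r => env_atom (env8 r) w) q
        (fun i => ev (env8 q) (der_atom (der8 i) w)).
    move=> wE d0 dE xw.
    apply: (eq_has_partials (amb_domain_open Uopen) _ (conj t0 Ux) _
      (@amb_x_has_partials _ _ (fun k => ev (E6 (amb_x q)) (der_atom (der6 k) w))
         q (jm_atom M6 w Ux))) => [r _|i]; first by rewrite wE.
    case: ifP => [/d0 -> |/negbT/dE ->]; first by rewrite ev_nil.
    by rewrite ev_x_poly.
  have x_jet a b : x_poly (jet a b) by rewrite /jet; case: ifP.
  case: v => [j|a b|s|i|i]; last 3 first.
  + by apply: atom0 => // i; rewrite /der8; do 2?case: ifP.
  + by apply: atom0 => // j; rewrite /der8; do 2?case: ifP.
  + by apply: atom0 => // j; rewrite /der8; do 2?case: ifP.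
  + have [->|j7] := eqVneq j 7%N.
      have [dF FE] := amb_rho_has_partials q; split=> // i; rewrite FE /der8.
      by case: eqP => [-> |_]; [|case: ifP => _]; rewrite ?ev_nil ?ev_one.
    have jE (T : Type) (x y : T) : (if j is 7 then x else y) = y.
      by move: j7; do 8?[case: j => // j].
    apply: atom_x => [r|i|i|i].
    * by rewrite /= jE.
    * by rewrite /der8; case: ifP => //= _; case: ifP => //= _; rewrite jE.
    * rewrite /der8 negb_or => /andP[/negbTE -> /negbTE ->] /=.
      by rewrite jE.
    * by rewrite /=; case: ifP.
  + apply: atom_x => // [i|i|i].
    * by rewrite /der8; case: ifP => //= _; case: ifP.
    * by rewrite /der8 negb_or => /andP[/negbTE -> /negbTE ->].
    * by rewrite /=; case: ifP => // _; case: ifP.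
Qed.

Definition gamb : 'rV[R]_(1 + 6 + 1) -> 'M[R]_(1 + 6 + 1) :=
  amb_form (fun p rho => gD f p + (2 * rho) *: schouten (gD f) p).

Lemma x_table_at t : x_table t -> forall i j, x_poly (at2 t i j).
Proof.
move=> /all_nthP xt i j; rewrite /at2.
have [ti|ti] := ltnP i (size t); last by rewrite [nth [::] t i]nth_default // nth_nil.
have /all_nthP xti := xt [::] i ti.
have [tj|tj] := ltnP j (size (nth [::] t i)); first exact: xti.
by rewrite nth_default.
Qed.

Lemma ev_two_rho q : ev (env8 q) two_rho = 2 * amb_rho q.
Proof. by rewrite evZ ev_atom /= -[evc R _]/(2 / 1 : R) divr1. Qed.

Lemma rep_amb_x (g P : table2) (k l : 'I_6) q :
  x_table g -> x_table P -> rep2 U E6 (gD f) g ->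
  rep2 U E6 (schouten (gD f)) P -> amb_domain U q ->
  ev (env8 q) (pmul (punit 0 2) (padd (at2 g k l) (pmul two_rho (at2 P k l)))) =
  amb_t q ^+ 2 * (gD f (amb_x q) + (2 * amb_rho q) *: schouten (gD f) (amb_x q)) k l.
Proof.
move=> xg xP gE PE Dq; have uq := jm_unit model8 Dq.
rewrite evM // evD evM // ev_two_rho.
rewrite (ev_x_poly _ (x_table_at xg k l)) (ev_x_poly _ (x_table_at xP k l)).
rewrite -(gE k l _ Dq.2) -(PE k l _ Dq.2) ev_unit /= expr0z mul1r.
by move: (gD f _) (schouten _ _) => a b; rewrite !mxE.
Qed.

(** Arbitrary tables stand for those of g and P, which keeps the concrete polynomials out of the
    goals. *)
Lemma rep_amb_table (g P : table2) :
  x_table g -> x_table P -> rep2 U E6 (gD f) g ->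
  rep2 U E6 (schouten (gD f)) P ->
  rep2 (amb_domain U) env8 gamb (amb_table g P).
Proof.
move=> xg xP gE PE.
move=> i j q Dq; rewrite at_tab2.
have tq : ev (env8 q) (punit 0 1) = amb_t q.
  by rewrite ev_unit /= expr0z mul1r expr1z.
rewrite /gamb /amb_form; set h := gD _ _ + _.
have dtE : (amb_dt : 'rV[R]_(1 + 6 + 1)) 0 =1 fun i => (i == 0%N :> nat)%:R.
  by move=> a; rewrite mxE eqxx -val_eqE.
have drE : (amb_drho : 'rV[R]_(1 + 6 + 1)) 0 =1 fun i => (i == 7%N :> nat)%:R.
  by move=> a; rewrite mxE eqxx -val_eqE.
have sE : (2 *: sprod (amb_drhot q) amb_dt) i j =
    (amb_rho q * (i == 0%N :> nat)%:R + amb_t q * (i == 7%N :> nat)%:R)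
      * (j == 0%N :> nat)%:R
    + (amb_rho q * (j == 0%N :> nat)%:R + amb_t q * (j == 7%N :> nat)%:R)
      * (i == 0%N :> nat)%:R.
  rewrite /sprod; move: dtE drE; rewrite /amb_drhot.
  move: (amb_dt : 'rV[R]_(1 + 6 + 1)) (amb_drho : 'rV[R]_(1 + 6 + 1)) => a b aE bE.
  by rewrite !mxE !big_ord1 !mxE !aE !bE; field.
have pE : (amb_t q ^+ 2 *: amb_pull h) i j = amb_t q ^+ 2 * amb_pull h i j.
  by rewrite mxE.
rewrite [LHS]mxE sE pE; clear pE sE dtE drE.
have xE (m : 'I_6) : lshift 1 (rshift 1 m) = m.+1 :> nat by [].
have x_index (m : 'I_6) : ((m.+1 == 0)%N = false) * ((m.+1 == 7)%N = false).
  by have := ltn_ord m; split; apply/eqP; lia.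
(* Nine blocks, each index being t, rho or an x-direction; g and P enter the last one only. *)
have [i0|i7|[k ->]] := amb_index i; have [j0|j7|[l ->]] := amb_index j.
- by rewrite amb_pull_0l ?i0 ?j0 //= ev_two_rho; ring.
- by rewrite amb_pull_0l ?i0 ?j7 //= tq; ring.
- by rewrite amb_pull_0l ?i0 // !xE !x_index /= ev_nil /=; ring.
- by rewrite amb_pull_0l ?i7 ?j0 //= tq; ring.
- by rewrite amb_pull_0l ?i7 ?j7 //= ev_nil; ring.
- by rewrite amb_pull_0l ?i7 // !xE !x_index /= ev_nil /=; ring.
- by rewrite amb_pull_0r ?j0 // !xE !x_index /= ev_nil /=; ring.
- by rewrite amb_pull_0r ?j7 // !xE !x_index /= ev_nil /=; ring.
rewrite amb_pull_x -(rep_amb_x k l xg xP gE PE Dq) !xE !x_index !succnK orbF.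
by rewrite !mulr0 !add0r.
Qed.

Lemma rep_amb : rep2 (amb_domain U) env8 gamb sym_amb.
Proof.
have [_ _ _ xg xP] := computed_ambient.
have gE := rep_gD Uopen Uopen (@subset_refl _ U) adm s0.
have PE := rep_schouten_gD Uopen Uopen (@subset_refl _ U) adm s0.
exact: rep_amb_table xg xP gE PE.
Qed.

Lemma amb_ricci_flat q : amb_domain U q -> ricci gamb q = 0.
Proof.
move=> Dq; have [id8 _ ric0 _ _] := computed_ambient.
have [invE _] := rep_invmx model8 rep_amb id8.
exact: (rep2_eq0 (rep_ricci model8 rep_amb invE) ric0 Dq).
Qed.

Lemma amb_metric_on : metric_on (amb_domain U) gamb.
Proof.
have [id8 sym8 _ _ _] := computed_ambient.
split=> [i j|q Dq|q Dq].
- exact: (rep_smooth model8 (rep_amb i j)).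
- apply/matrixP => i j; rewrite mxE (rep_amb j i Dq) (rep_amb i j Dq).
  exact: eq_table2_tr sym8 _ _.
- by have [_] := rep_invmx model8 rep_amb id8; apply.
Qed.

Lemma ambient_metric_gD : ambient_metric U (gD f)
  (fun p rho => gD f p + (2 * rho) *: schouten (gD f) p).
Proof.
split=> [p _| |]; first by rewrite mulr0 scale0r addr0.
- exact: amb_metric_on.
- exact: amb_ricci_flat.
Qed.

End Ambient.

(** * Genericity *)

(** The model on the (x^1, x^3)-plane, with [u2] constantly 1. The atoms of index 0 depend on x^1
    alone; those of positive index are functions of f - c and follow the chain rule. *)
Definition der2 (i : nat) : derivation := Derivation
  (if i == 0%N then jet 1 1 else jet 0 2) [::]
  (fun v => match v with
   | Jet a b => if i == 0%N then jet a.+1 b else jet a b.+1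
   | Sin 0 => if i == 0%N then patom (Cos 0) else [::]
   | Cos 0 => if i == 0%N then pscale ((-1)%BZ, 0%N) (patom (Sin 0)) else [::]
   | Sin k => pmul (patom (Cos k)) (if i == 0%N then jet 1 0 else jet 0 1)
   | Cos k => pmul (pscale ((-1)%BZ, 0%N) (patom (Sin k)))
                   (if i == 0%N then jet 1 0 else jet 0 1)
   | _ => [::]
   end).

(* The value at a point where both sines vanish and both cosines are 1. *)
Definition at_zero (P : lpoly) : lpoly := psum [seq
  [:: (t.1, (t.2.1, [seq x <- t.2.2 | if x.1 is Cos _ then false else true]))]
  | t <- P & all (fun x : atom * nat =>
                    if x.1 is Sin _ then x.2 == 0%N else true) t.2.2].

Lemma ev_at_zero (R : numFieldType) (e : env R) P :
  (forall k, env_atom e (Sin k) = 0) -> (forall k, env_atom e (Cos k) = 1) ->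
  ev e (at_zero P) = ev e P.
Proof.
move=> sinE cosE; rewrite /at_zero ev_psum big_map big_filter big_mkcond.
apply: eq_bigr => t _ /=.
have tE : evl e t.2.2 = if all (fun x : atom * nat =>
      if x.1 is Sin _ then x.2 == 0%N else true) t.2.2
    then evl e [seq x <- t.2.2 | if x.1 is Cos _ then false else true] else 0.
  elim: (t.2.2) => //= -[v n] l /= ->; case: ifP => lS; last first.
    by rewrite andbF mulr0.
  rewrite andbT; case: v => [j|a b|s|k|k] //.
    by rewrite sinE; case: eqP => [-> //|/eqP n0]; rewrite expr0n (negbTE n0) mul0r.
  by rewrite cosE expr1n mul1r.
rewrite [in RHS]/evm tE; case: ifP => _; last by rewrite !mulr0.
by rewrite ev_cons ev_nil addr0.
Qed.

Definition jder a b (P : lpoly) : lpoly :=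
  iter a (pder (der2 0)) (iter b (pder (der2 1)) P).

(* At a point where both sines vanish, the only derivatives of order at most 4
   of the two bumps below that enter the argument and are not 0 are d_333 for
   the first one and d_1133 for the second one. *)
Definition bump03 : lpoly :=
  [:: ((1%BZ, 0%N), (0%BZ, 0%BZ, [:: (Sin 1, 3%N)]))].
Definition bump22 : lpoly :=
  [:: ((1%BZ, 0%N), (0%BZ, 0%BZ, [:: (Sin 0, 2%N); (Sin 1, 2%N)]))].

(** The quotients by f_3 of the x^3-derivatives of the two bumps: 3 sin^2 cos and 2 sin^2 sin cos,
    both at most 3 in absolute value. *)
Definition bump03_slope : lpoly :=
  [:: ((3%BZ, 0%N), (0%BZ, 0%BZ, [:: (Sin 1, 2%N); (Cos 1, 1%N)]))].
Definition bump22_slope : lpoly :=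
  [:: ((2%BZ, 0%N), (0%BZ, 0%BZ, [:: (Sin 0, 2%N); (Sin 1, 1%N); (Cos 1, 1%N)]))].

(* The Cotton component is affine in f_1133, with slope
   (4 f_33^2 - 3 f_3 f_333) / (108 f_3^5). *)
Definition slope22 : lpoly :=
  psub (pscale (4%BZ, 0%N) (pmul (patom (Jet 0 2)) (patom (Jet 0 2))))
       (pscale (3%BZ, 0%N) (pmul (punit 1 0) (patom (Jet 0 3)))).
Definition rest22 : lpoly := [seq t <- sym_C424 |
  all (fun x : atom * nat => if x.1 is Jet 2 2 then false else true) t.2.2].
Definition is_jet4 (v : atom) : bool :=
  if v is Jet a b then (a + b <= 4)%N else false.
(** The jets besides f_3 from which the slope and the remainder are built; the second bump changes
    none of them at its centre. *)
Definition is_jet_rest (v : atom) : bool :=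
  if v is Jet a b then
    ((a, b) \in [:: (0, 2); (0, 3); (0, 4); (1, 1); (1, 2); (1, 3); (2, 1)])%N
  else false.

(** At its centre the first bump has third x^3-derivative 6 f_3^3, and the second has d_1133 equal
    to 4 f_3^2. The constant 250 / 30^3 is 1/108. *)
Lemma computed_bumps :
  [/\ [&& peqb (at_zero (jder 0 1 bump03)) [::],
         peqb (at_zero (jder 0 2 bump03)) [::]
       & peqb (at_zero (jder 0 3 bump03)) (pscale (6%BZ, 0%N) (punit 3 0))],
     all (fun ab : nat * nat => peqb (at_zero (jder ab.1 ab.2 bump22)) [::])
       [:: (0, 1); (0, 2); (0, 3); (0, 4); (1, 1); (1, 2); (1, 3); (2, 1)]%N &&
     peqb (at_zero (jder 2 2 bump22)) (pscale (4%BZ, 0%N) (punit 2 0)),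
     peqb (pder (der2 1) bump03) (pmul (punit 1 0) bump03_slope) &&
     peqb (pder (der2 1) bump22) (pmul (punit 1 0) bump22_slope) &
     [&& peqb sym_C424 (padd (pmul (pmul (pscale (250%BZ, 3%N) (punit (-5) 0))
                                          slope22) (patom (Jet 2 2))) rest22),
         only_atoms is_jet4 sym_C424, only_atoms is_jet_rest slope22
       & only_atoms is_jet_rest rest22]].
Proof. by apply/and4P; vm_compute. Qed.

(** * Small perturbations of f by bumps *)

Section Perturbations.
Variables (R : realType) (D : set 'rV[R]_2) (f : 'rV[R]_2 -> R) (a0 c0 : R).
Hypotheses (Dopen : open D) (adm : admissible D f).

Let o0 : 'I_2 := Ordinal (isT : 0 < 2)%N.
Let o1 : 'I_2 := Ordinal (isT : 1 < 2)%N.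

Definition env2 (q : 'rV[R]_2) : env R := Env (d3 f q) 1 (fun v => match v with
  | Jet a b => jets f a b q
  | Sin 0 => sin (q 0 ord0 - a0)
  | Cos 0 => cos (q 0 ord0 - a0)
  | Sin _ => sin (f q - c0)
  | Cos _ => cos (f q - c0)
  | _ => 0
  end).

Let ev2_jet q a b : ev (env2 q) (jet a b) = jets f a b q.
Proof.
rewrite /jet; case: ifP => [/andP[/eqP -> /eqP ->]|_]; last by rewrite ev_atom.
by rewrite ev_unit /= expr1z mulr1.
Qed.

Lemma ord2_case (i : 'I_2) : i = o0 \/ i = o1.
Proof. by case: i => -[|[|//]] i2; [left|right]; apply: val_inj. Qed.

Let jets_has_partials2 a b q : D q -> has_partials (jets f a b) q
  (fun i => if i == 0%N :> nat then jets f a.+1 b q else jets f a b.+1 q).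
Proof.
move=> Dq; split=> [|i]; first exact: adm.1.
have [->|->] := ord2_case i; rewrite /= /jets //.
by rewrite (partial_insert Dopen adm.1 _ _ _ Dq).
Qed.

Lemma model2 : jet_model D env2 der2.
Proof.
split=> // [q Dq|q Dq|q Dq|v q Dq].
- by split; [exact: adm.2|exact: oner_neq0].
- have [dF FE] := jets_has_partials2 0 1 Dq; split=> // i; rewrite FE.
  by rewrite /der2 /=; case: ifP => _; rewrite ev2_jet.
- have [dF FE] := has_partials_cst 1 q; split=> // i; rewrite FE.
  by rewrite ev_nil.
have uq : unit_env (env2 q) by split; [exact: adm.2|exact: oner_neq0].
have dx : has_partials (fun r : 'rV[R]_2 => r 0 ord0 - a0) q
    (fun i => (i == 0%N :> nat)%:R).
  have [dF FE] := has_partialsD (coord_has_partials q ord0) (has_partials_cst (- a0) q).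
  by split=> // i; rewrite FE addr0.
have df : has_partials (fun r => f r - c0) q
    (fun i => if i == 0%N :> nat then jets f 1 0 q else jets f 0 1 q).
  have [dF FE] := has_partialsD (jets_has_partials2 0 0 Dq) (has_partials_cst (- c0) q).
  by split=> // i; rewrite FE addr0.
have zero (w : atom) : (forall i, der_atom (der2 i) w = [::]) ->
    (forall r, env_atom (env2 r) w = 0) ->
    has_partials (fun r => env_atom (env2 r) w) q
      (fun i => ev (env2 q) (der_atom (der2 i) w)).
  move=> dw w0; have [dF FE] := has_partials_cst 0 q.
  rewrite (_ : (fun r => _) = cst 0); last by apply/funext => r; exact: w0.
  by split=> // i; rewrite FE dw ev_nil.
case: v => [j|a b|s|[|k]|[|k]]; try by apply: zero.
- have [dF FE] := jets_has_partials2 a b Dq; split=> // i; rewrite FE /=.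
  by case: ifP => _; rewrite ev2_jet.
- have [dF FE] := has_partials_comp (is_derive_sin _) dx; split=> // i; rewrite FE /=.
  by case: ifP => _; rewrite ?ev_atom ?ev_nil /= ?mulr1 ?mulr0.
- have [dF FE] := has_partials_comp (is_derive_sin _) df; split=> // i; rewrite FE.
  rewrite -[der_atom _ _]/(pmul (patom (Cos k.+1))
    (if i == 0%N :> nat then jet 1 0 else jet 0 1)).
  by rewrite evM // ev_atom; case: ifP => _; rewrite ev2_jet.
- have [dF FE] := has_partials_comp (is_derive_cos _) dx; split=> // i; rewrite FE /=.
  have m1 : evc R ((-1)%BZ, 0%N) = -1 by rewrite -[LHS]/(-1 / 1 : R) divr1.
  case: ifP => _; rewrite ?ev_nil ?mulr0 // mulr1.
  by rewrite [RHS](evZ (env2 q) ((-1)%BZ, 0%N) (patom (Sin 0))) m1 ev_atom mulN1r.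
- have [dF FE] := has_partials_comp (is_derive_cos _) df; split=> // i; rewrite FE.
  rewrite -[der_atom _ _]/(pmul (pscale ((-1)%BZ, 0%N) (patom (Sin k.+1)))
    (if i == 0%N :> nat then jet 1 0 else jet 0 1)).
  have m1 : evc R ((-1)%BZ, 0%N) = -1 by rewrite -[LHS]/(-1 / 1 : R) divr1.
  by rewrite evM // evZ m1 ev_atom mulN1r; case: ifP => _; rewrite ev2_jet.
Qed.

(** The maximum of the continuous function P^2 on K bounds P from both sides, because |x| is at most
    1 + x^2. *)
Lemma ev_bounded_on_compact K P : compact K -> K `<=` D ->
  exists2 B, 0 <= B & forall q, K q -> `|ev (env2 q) P| <= B.
Proof.
move=> Kc KD; have [K0|K0] := pselect (K !=set0); last first.
  by exists 0 => // q Kq; case: K0; exists q.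
have cP : {within K, continuous (fun q => ev (env2 q) (pmul P P))}.
  apply: continuous_in_subspaceT => q /[!inE] /KD Dq.
  exact/differentiable_continuous/(ev_has_partials model2 (pmul P P) Dq).1.
have [c Kc' cmax] := EVT_max_rV K0 Kc cP.
have PP q : K q -> ev (env2 q) (pmul P P) = ev (env2 q) P * ev (env2 q) P.
  by move=> /KD Dq; rewrite evM //; exact: (jm_unit model2 Dq).
exists (1 + ev (env2 c) (pmul P P)).
  by move: Kc'; rewrite inE => /PP ->; rewrite addr_ge0 // -expr2 sqr_ge0.
move=> q Kq; have := cmax q; rewrite inE => /(_ Kq).
rewrite PP //; move: (ev (env2 q) P) (ev (env2 c) _) => x y xy.
have : 0 <= x * x by rewrite -expr2 sqr_ge0.
have := sqr_ge0 (x - 1); have := sqr_ge0 (x + 1); rewrite !expr2 => h1 h2 h3.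
by rewrite ler_norml; apply/andP; split; nra.
Qed.

(** Splitting off the last index, which is the derivative applied first, turns a bound of order k +
    1 for P into bounds of order k for its two first derivatives; hence the induction ranges over
    all P. *)
Lemma partials_bounded_on_compact K P k : compact K -> K `<=` D ->
  exists2 B, 0 <= B & forall (s : seq 'I_2) q, (size s <= k)%N -> K q ->
    `|ev (env2 q) (pders der2 s P)| <= B.
Proof.
move=> Kc KD; elim: k P => [|k IH] P.
  have [B B0 PB] := ev_bounded_on_compact P Kc KD.
  by exists B => // -[|//] q _; exact: PB.
have [B B0 PB] := ev_bounded_on_compact P Kc KD.
have [B1 B10 PB1] := IH (pder (der2 0) P).
have [B2 B20 PB2] := IH (pder (der2 1) P).
exists (B + B1 + B2); first by rewrite !addr_ge0.
move=> s q; case/lastP: s => [_ Kq|s i].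
  by rewrite (le_trans (PB q Kq)) // -addrA lerDl addr_ge0.
rewrite size_rcons ltnS => sk Kq; rewrite /pders foldr_rcons.
have [->|->] := ord2_case i.
  by rewrite (le_trans (PB1 s q sk Kq)) // addrAC lerDr addr_ge0.
by rewrite (le_trans (PB2 s q sk Kq)) // lerDr addr_ge0.
Qed.

Definition perturbation (P : lpoly) (eps : R) : 'rV[R]_2 -> R :=
  fun q => f q + eps * ev (env2 q) P.

Lemma partials_perturbation P eps s q : D q ->
  partials s (perturbation P eps) q =
  partials s f q + eps * ev (env2 q) (pders der2 s P).
Proof.
elim: s q => [//|i s IH] q Dq /=.
have dfs : has_partials (partials s f) q (fun i => partial i (partials s f) q).
  by split=> //; exact: adm.1.
have dP := has_partialsM (has_partials_cst eps q)
  (ev_has_partials model2 (pders der2 s P) Dq).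
have [_ dE] := eq_has_partials Dopen (fun r Dr => esym (IH r Dr)) Dq
  (fun i => erefl) (has_partialsD dfs dP).
by rewrite dE /cst mul0r add0r.
Qed.

Lemma smooth_perturbation P eps : smooth_on D (perturbation P eps).
Proof.
move=> s q Dq.
have dfs : has_partials (partials s f) q (fun i => partial i (partials s f) q).
  by split=> //; exact: adm.1.
have dP := has_partialsM (has_partials_cst eps q)
  (ev_has_partials model2 (pders der2 s P) Dq).
by have [] := eq_has_partials Dopen
  (fun r Dr => esym (partials_perturbation P eps s Dr)) Dq
  (fun i => erefl) (has_partialsD dfs dP).
Qed.

(* Since d_3 P = f_3 X with X bounded, d_3 (f + eps P) = f_3 (1 + eps X) does
   not vanish on D for small eps, even when D is not relatively compact. *)
Lemma small_perturbation P X K k e : compact K -> K `<=` D -> 0 < e ->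
  peqb (pder (der2 1) P) (pmul (punit 1 0) X) ->
  (forall q, `|ev (env2 q) X| <= 3) ->
  exists2 eps, eps != 0 & admissible D (perturbation P eps) /\
    Cinfty_near f k K e (perturbation P eps).
Proof.
move=> Kc KD e0 dP X3; have [B B0 PB] := partials_bounded_on_compact P k Kc KD.
(* With eps = e / (B + 1 + 3 e) both eps B < e, for closeness on K, and 3 eps < 1, for positivity of
   1 + eps X, hold. *)
have N0 : 0 < B + 1 + 3 * e by rewrite addr_gt0 ?mulr_gt0 // ltr_wpDl.
have eps0 : 0 < e / (B + 1 + 3 * e) by rewrite divr_gt0.
have epsN : e / (B + 1 + 3 * e) * (B + 1 + 3 * e) = e by rewrite divfK ?gt_eqF.
move: (e / _) eps0 epsN => eps eps0 epsN; clear N0.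
exists eps; first by rewrite gt_eqF.
split; first (split; first exact: smooth_perturbation).
  move=> q Dq; have uq := jm_unit model2 Dq.
  rewrite /d3 -[partial _ _]/(partials [:: o1] (perturbation P eps)).
  rewrite partials_perturbation // -[pders _ _ _]/(pder (der2 1) P).
  rewrite (peqbP _ dP) evM // ev_unit /= expr1z mulr1 mulrCA.
  rewrite -[X in X + _]mulr1 -mulrDr mulf_neq0 //; first exact: adm.2.
  have := X3 q; rewrite ler_norml => /andP[Xl _].
  rewrite gt_eqF //; nra.
move=> s q sk Kq; rewrite partials_perturbation; last exact: KD.
rewrite addrC addKr normrM gtr0_norm //.
have := PB s q sk Kq; have := normr_ge0 (ev (env2 q) (pders der2 s P)).
nra.
Qed.


Lemma jets_perturbation P eps a b q : D q ->
  jets (perturbation P eps) a b q = jets f a b q + eps * ev (env2 q) (jder a b P).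
Proof.
move=> Dq; rewrite /jets partials_perturbation //; congr (_ + _ * ev _ _).
have foldrE c (i : 'I_2) Q : foldr (fun j : 'I_2 => pder (der2 j)) Q (nseq c i)
    = iter c (pder (der2 i)) Q by elim: c => //= c ->.
by rewrite /pders foldr_cat !foldrE.
Qed.

End Perturbations.

(** * Continuity of evaluation in the environment *)

Section EvaluationLimits.
Variables (R : realType) (T : Type) (F : set_system T).
Context {FF : Filter F}.

Lemma cvg_exprz (u : T -> R) (l : R) (z : int) : l != 0 ->
  u x @[x --> F] --> l -> u x ^ z @[x --> F] --> l ^ z.
Proof.
move=> l0 ul; have ulX m : u x ^+ m @[x --> F] --> l ^+ m.
  elim: m => [|m IH]; first by rewrite expr0; exact: cvg_cst.
  rewrite exprS (_ : (fun x => _) = fun x => u x * u x ^+ m); first exact: cvgM.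
  by apply/funext => x; rewrite exprS.
case: z => m; first exact: ulX.
by apply: cvgV; [rewrite expf_neq0|exact: ulX].
Qed.

(** The filter is arbitrary because the limit is taken over functions: they tend to f in the sense
    of derivatives of order at most 4 at one point. *)
Lemma cvg_ev (e : T -> env R) e0 (ok : atom -> bool) P : only_atoms ok P ->
  env_u1 e0 != 0 -> env_u1 (e x) @[x --> F] --> env_u1 e0 ->
  (forall v, ok v -> env_atom (e x) v @[x --> F] --> env_atom e0 v) ->
  ev (e x) P @[x --> F] --> ev e0 P.
Proof.
move=> + u0 u1l atl; elim: P => [_|t P IH].
  rewrite ev_nil (_ : (fun x => _) = cst 0); first exact: cvg_cst.
  by apply/funext => x; rewrite ev_nil.
rewrite /= => /andP[/andP[/Z.eqb_eq t0 okt] /IH Pl].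
rewrite ev_cons (_ : (fun x => _) = fun x => evc R t.1 *
    (env_u1 (e x) ^ int_of_Z t.2.1.1 * evl (e x) t.2.2) + ev (e x) P); last first.
  by apply/funext => x; rewrite ev_cons /evm t0 /= expr0z mulr1.
rewrite /evm t0 /= expr0z mulr1; apply: cvgD => //.
apply: cvgM; first exact: cvg_cst.
apply: cvgM; first exact: cvg_exprz.
elim: (t.2.2) okt => [_|[v m] l IHl] /=; first exact: cvg_cst.
move=> /andP[okv /IHl ll]; apply: cvgM => //.
elim: m => [|m IHm]; first by rewrite expr0; exact: cvg_cst.
rewrite exprS (_ : (fun x => _) = fun x => env_atom (e x) v * env_atom (e x) v ^+ m).
  by apply: cvgM => //; exact: atl.
by apply/funext => x; rewrite exprS.
Qed.

End EvaluationLimits.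

(** * Openness and density of a jet condition at one point *)

Section Genericity.
Variable R : realType.
Implicit Types (f h : 'rV[R]_2 -> R) (q : 'rV[R]_2) (D : set 'rV[R]_2).

Definition jet_env f q : env R := Env (d3 f q) 1
  (fun v => if v is Jet a b then jets f a b q else 0).

Lemma Cinfty_near_trans f g h k K (e1 e2 : R) :
  Cinfty_near f k K e1 g -> Cinfty_near g k K e2 h ->
  Cinfty_near f k K (e1 + e2) h.
Proof.
move=> fg gh s q sk Kq; have := ltrD (fg s q sk Kq) (gh s q sk Kq).
apply: le_lt_trans; move: (partials s h q) (partials s f q) => x y.
have -> : x - y = (partials s g q - y) + (x - partials s g q) by ring.
exact: ler_normD.
Qed.

Lemma Cinfty_near_refl f k K (e : R) : 0 < e -> Cinfty_near f k K e f.
Proof. by move=> e0 s q _ _; rewrite subrr normr0. Qed.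

(** The sets of functions whose derivatives up to order 4 at q are close to those of f generate a
    filter. Along it the 4-jet at q converges, hence so does the value of P, and a nonzero limit
    excludes the value 0. *)
Lemma ev_jet_env_open f q P : d3 f q != 0 -> only_atoms is_jet4 P ->
  ev (jet_env f q) P != 0 ->
  exists2 e : R, 0 < e & forall h, Cinfty_near f 4 [set q] e h ->
    ev (jet_env h q) P != 0.
Proof.
move=> f3 P4 P0.
pose F := filter_from [set e : R | 0 < e] (Cinfty_near f 4 [set q]).
have FF : Filter F.
  apply: filter_from_filter; first by exists 1; exact: ltr01.
  move=> e1 e2 /= e10 e20; exists (Num.min e1 e2); first by rewrite /= lt_min e10.
  by move=> h hn; split=> s r sk Kr; have := hn s r sk Kr; rewrite lt_min => /andP[].
have jl a b : (a + b <= 4)%N -> jets h a b q @[h --> F] --> jets f a b q.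
  move=> ab; apply/cvgrPdist_lt => e e0; exists e => // h hn.
  by rewrite distrC; apply: hn => //; rewrite size_cat !size_nseq.
have evl : ev (jet_env h q) P @[h --> F] --> ev (jet_env f q) P.
  apply: (cvg_ev P4) => //; first exact: (jl 0%N 1%N).
  by case=> // a b; exact: jl.
have /cvgrPdist_lt/(_ `|ev (jet_env f q) P|) := evl.
rewrite normr_gt0 => /(_ P0) [e e0 eP]; exists e => // h /eP /=.
by apply: contraTneq => ->; rewrite subr0 ltxx.
Qed.

Lemma ev_slope22 f q : d3 f q != 0 -> ev (jet_env f q) slope22 =
  4 * jets f 0 2 q ^+ 2 - 3 * d3 f q * jets f 0 3 q.
Proof.
move=> f3; have uf : unit_env (jet_env f q) by split; rewrite ?oner_neq0.
rewrite evB !evZ !evM // !ev_atom ev_unit /= expr1z.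
rewrite -[evc R (4%BZ, 0%N)]/(4%:R / 1 : R) -[evc R (3%BZ, 0%N)]/(3%:R / 1 : R).
rewrite !divr1 exp1rz mulr1.
move: (d3 f q) (jets f 0 2 q) (jets f 0 3 q) => x y z; ring.
Qed.

Lemma norm_sin_le1 (x : R) : `|sin x| <= 1.
Proof. by rewrite ler_norml sin_geN1 sin_le1. Qed.

Lemma norm_cos_le1 (x : R) : `|cos x| <= 1.
Proof. by rewrite ler_norml cos_geN1 cos_le1. Qed.

Lemma bump_slope_le (c s1 s2 s3 : R) : 0 <= c <= 3 ->
  `|s1| <= 1 -> `|s2| <= 1 -> `|s3| <= 1 -> `|c * (s1 * (s2 * s3))| <= 3.
Proof.
move=> /andP[c0 c3] h1 h2 h3; rewrite !normrM ger0_norm //.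
rewrite (le_trans _ c3) // -[leRHS]mulr1 ler_wpM2l //.
by rewrite mulr_ile1 ?mulr_ge0 // mulr_ile1.
Qed.

Lemma bump03_slope_le f a0 c0 q : `|ev (env2 f a0 c0 q) bump03_slope| <= 3.
Proof.
rewrite ev_cons ev_nil /evm /= expr2 !mulr1 !mul1r expr1 addr0.
rewrite -[evc R _]/(3%:R / 1 : R) divr1 -!mulrA.
by apply: bump_slope_le; rewrite ?norm_sin_le1 ?norm_cos_le1 // ler0n lexx.
Qed.

Lemma bump22_slope_le f a0 c0 q : `|ev (env2 f a0 c0 q) bump22_slope| <= 3.
Proof.
rewrite ev_cons ev_nil /evm /= !mulr1 !mul1r !expr1 addr0.
rewrite -[evc R _]/(2%:R / 1 : R) divr1; apply: bump_slope_le.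
- by rewrite ler0n ler_nat.
- by rewrite normrX exprn_ile1 ?norm_sin_le1.
- exact: norm_sin_le1.
- exact: norm_cos_le1.
Qed.

(** The bump is centred at q, with a the x^1-coordinate of q and c = f(q), so both sines vanish
    there and both cosines are 1. *)
Lemma jets_bump D f P eps a b q Q : open D -> admissible D f -> D q ->
  peqb (at_zero (jder a b P)) Q ->
  jets (perturbation f (q 0 ord0) (f q) P eps) a b q =
  jets f a b q + eps * ev (env2 f (q 0 ord0) (f q) q) Q.
Proof.
move=> Dopen adm Dq PQ; rewrite (jets_perturbation _ _ Dopen adm) //.
rewrite -(peqbP _ PQ) ev_at_zero // => -[|k] /=; by rewrite subrr ?sin0 ?cos0.
Qed.

Lemma slope22_dense D f q k K e : open D -> D q -> admissible D f ->
  compact K -> K `<=` D -> 0 < e ->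
  exists2 h, admissible D h & Cinfty_near f k K e h /\
    ev (jet_env h q) slope22 != 0.
Proof.
move=> Dopen Dq adm Kc KD e0; have f3 := adm.2 q Dq.
have [S0|S0] := eqVneq (ev (jet_env f q) slope22) 0; last first.
  by exists f => //; split=> //; exact: Cinfty_near_refl.
have [/and3P[z01 z02 z03] _ /andP[dP _] _] := computed_bumps.
have [eps eps0 [admh hn]] := small_perturbation (a0 := q 0 ord0) (c0 := f q)
  Dopen adm k Kc KD e0 dP (bump03_slope_le _ _ _).
set h := perturbation _ _ _ _ _ in admh hn; exists h; first exact: admh.
split; first exact: hn.
rewrite ev_slope22; last exact: admh.2.
have jE a b Q : peqb (at_zero (jder a b bump03)) Q ->
    jets h a b q = jets f a b q + eps * ev (env2 f (q 0 ord0) (f q) q) Q.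
  by move=> zQ; exact: (jets_bump eps Dopen adm Dq zQ).
clearbody h.
have h01 : d3 h q = d3 f q.
  by have := jE 0%N 1%N _ z01; rewrite ev_nil mulr0 addr0.
have h02 : jets h 0 2 q = jets f 0 2 q.
  by rewrite (jE _ _ _ z02) ev_nil mulr0 addr0.
have h03 : jets h 0 3 q = jets f 0 3 q + eps * (6 * d3 f q ^+ 3).
  rewrite (jE _ _ _ z03) evZ ev_unit [env_u2 _]/= exp1rz mulr1.
  by rewrite -[evc R _]/(6%:R / 1 : R) divr1.
(* The old slope is 0, so the new one equals -3 f_3 times 6 eps f_3^3. *)
rewrite h01 h02 h03; move: S0; rewrite (ev_slope22 f3) => S0.
rewrite mulrDr opprD addrA S0 add0r oppr_eq0 !mulf_neq0 ?pnatr_eq0 //.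
Qed.

(** Of the jets occurring in C the second bump changes only f_1133, by 4 eps f_3^2, so a vanishing C
    becomes the nonzero product of this change and the slope. The polynomials are kept abstract so
    that the computed Cotton component is never unfolded. *)
Lemma affine_dense (C S rest : lpoly) D f q k K e :
  peqb C (padd (pmul (pmul (pscale (250%BZ, 3%N) (punit (-5) 0)) S)
                     (patom (Jet 2 2))) rest) ->
  only_atoms is_jet_rest S -> only_atoms is_jet_rest rest ->
  open D -> D q -> admissible D f ->
  compact K -> K `<=` D -> 0 < e -> ev (jet_env f q) S != 0 ->
  exists2 h, admissible D h & Cinfty_near f k K e h /\
    ev (jet_env h q) C != 0.
Proof.
move=> CE S_ok rest_ok Dopen Dq adm Kc KD e0 S0; have f3 := adm.2 q Dq.
have [C0|C0] := eqVneq (ev (jet_env f q) C) 0; last first.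
  by exists f => //; split=> //; exact: Cinfty_near_refl.
have [_ /andP[z z22] /andP[_ dP] _] := computed_bumps.
have [eps eps0 [admh hn]] := small_perturbation (a0 := q 0 ord0) (c0 := f q)
  Dopen adm k Kc KD e0 dP (bump22_slope_le _ _ _).
set h := perturbation _ _ _ _ _ in admh hn; exists h; first exact: admh.
split; first exact: hn.
have jE a b Q : peqb (at_zero (jder a b bump22)) Q ->
    jets h a b q = jets f a b q + eps * ev (env2 f (q 0 ord0) (f q) q) Q.
  by move=> zQ; exact: (jets_bump eps Dopen adm Dq zQ).
clearbody h.
have j0 a b : (a, b) \in [:: (0, 1); (0, 2); (0, 3); (0, 4); (1, 1); (1, 2);
    (1, 3); (2, 1)]%N -> jets h a b q = jets f a b q.
  by move=> /(allP z) /jE ->; rewrite ev_nil mulr0 addr0.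
have h22 : jets h 2 2 q = jets f 2 2 q + eps * (4 * d3 f q ^+ 2).
  rewrite (jE _ _ _ z22) evZ ev_unit [env_u2 _]/= exp1rz mulr1.
  by rewrite -[evc R _]/(4%:R / 1 : R) divr1.
clear z z22 dP jE.
have h3 : d3 h q = d3 f q by exact: (j0 0%N 1%N).
have affine g : d3 g q != 0 -> ev (jet_env g q) C =
    250 / 30 ^+ 3 / d3 g q ^+ 5 * ev (jet_env g q) S * jets g 2 2 q
    + ev (jet_env g q) rest.
  move=> g3; have ug : unit_env (jet_env g q) by split; rewrite ?oner_neq0.
  rewrite (peqbP _ CE) evD (evM _ _ ug) ev_atom (evM _ _ ug) evZ ev_unit.
  by rewrite [env_u2 _]/= exp1rz mulr1.
have eq_evh Q : only_atoms is_jet_rest Q ->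
    ev (jet_env h q) Q = ev (jet_env f q) Q.
  move=> Q_ok; apply: (eq_ev Q_ok); first exact: h3.
  by case=> // a b ab; apply: j0; rewrite in_cons [X in _ || X]ab orbT.
have hf3 : d3 h q != 0 by rewrite h3.
rewrite (affine h hf3) (eq_evh S S_ok) (eq_evh rest rest_ok) h3; move: C0; rewrite (affine f f3).
rewrite h22 => C0; rewrite mulrDr addrAC C0 add0r !mulf_neq0 ?invr_eq0 ?expf_neq0 ?pnatr_eq0 //.
Qed.

(** Two successive perturbations, each within e / 2; the second bump is built from the already
    perturbed function. *)
Lemma cotton424_dense D f q k K e : open D -> D q -> admissible D f ->
  compact K -> K `<=` D -> 0 < e ->
  exists2 h, admissible D h & Cinfty_near f k K e h /\
    ev (jet_env h q) sym_C424 != 0.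
Proof.
move=> Dopen Dq adm Kc KD e0; have e20 : 0 < e / 2 by rewrite divr_gt0.
have [g admg [fg S0]] := slope22_dense k Dopen Dq adm Kc KD e20.
have [_ _ _ /and4P[CE _ S_ok rest_ok]] := computed_bumps.
have [h admh [gh C0]] :=
  affine_dense k CE S_ok rest_ok Dopen Dq admg Kc KD e20 S0.
exists h; first exact: admh.
split; last exact: C0.
by rewrite (splitr e); exact: Cinfty_near_trans fg gh.
Qed.

(** The potential drops out: the polynomial involves only jets of f of order at most 4 and no power
    of [u2], so [jet_env], which sees nothing but the jet at one point, gives the same value. *)
Lemma cotton_conf_jet (U V : set 'rV[R]_6) f (phi : 'rV[R]_6 -> R) p :
  open U -> open V -> V `<=` U -> admissible (pr13 @` U) f ->
  smooth_on V phi -> V p ->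
  cotton (conf_rescale phi (gD f)) p iy2 ix3 iy2 =
  ev (jet_env f (pr13 p)) sym_C424.
Proof.
move=> Uopen Vopen VU adm sphi Vp; rewrite (cotton_conf Uopen Vopen VU adm sphi Vp).
have [_ _ _ /and4P[_ C4 _ _]] := computed_bumps.
have atomE v : is_jet4 v ->
  env_atom (env6 f phi p) v = env_atom (jet_env f (pr13 p)) v by case: v.
have u1E : env_u1 (env6 f phi p) = env_u1 (jet_env f (pr13 p)) by [].
exact: (eq_ev C4 u1E atomE).
Qed.

(** Local flatness is tested at p, where the value of C_{424} is the same for every neighbourhood V
    and every phi. *)
Lemma not_conformally_flat (U : set 'rV[R]_6) f p : open U -> U p ->
  admissible (pr13 @` U) f -> ev (jet_env f (pr13 p)) sym_C424 != 0 ->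
  ~ conformally_cotton_flat U (gD f) /\ ~ conformally_einstein U (gD f).
Proof.
move=> Uopen Up adm C0.
have ncf (V : set 'rV[R]_6) phi : open V -> V p -> V `<=` U -> smooth_on V phi ->
    ~ cotton_flat_on V (conf_rescale phi (gD f)).
  move=> Vopen Vp VU sphi /(_ p Vp iy2 ix3 iy2).
  by rewrite (cotton_conf_jet Uopen Vopen VU adm sphi Vp) => /eqP; apply/negP.
split=> /(_ p Up) [V [phi [Vopen Vp VU sphi]]].
- exact: (ncf V phi Vopen Vp VU sphi).
- move=> /(einstein_cotton_flat Vopen (metric_conf Uopen Vopen VU adm sphi)).
  exact: (ncf V phi Vopen Vp VU sphi).
Qed.

(** The open dense set consists of the admissible f with C_{424} nonzero over one chosen point of U;
    openness is therefore witnessed by a one-point compact set and four derivatives. *)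
Lemma generically_not_conformally_flat (U : set 'rV[R]_6) :
  open U -> U !=set0 ->
  generically (pr13 @` U) (admissible (pr13 @` U))
    (fun f => ~ conformally_cotton_flat U (gD f)
              /\ ~ conformally_einstein U (gD f)).
Proof.
move=> Uopen [p Up]; set D := pr13 @` U.
have Dopen : open D by exact: pr13_open.
have Dp : D (pr13 p) by exists p.
have [_ _ _ /and4P[_ C4 _ _]] := computed_bumps.
exists [set f | admissible D f /\ ev (jet_env f (pr13 p)) sym_C424 != 0]; split.
- move=> f [adm C0]; split; first exact: adm.
  exact: not_conformally_flat Uopen Up adm C0.
- move=> f [adm C0]; have [e e0 eC] := ev_jet_env_open (adm.2 _ Dp) C4 C0.
  exists 4%N, [set pr13 p], e; split.
  + exact: compact_set1.
  + by move=> q ->.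
  + exact: e0.
  + by move=> h admh hn; split; [exact: admh|exact: eC].
- move=> f k K e adm Kc KD e0.
  have [h admh [fh C0]] := cotton424_dense k Dopen Dp adm Kc KD e0.
  by exists h; [split; [exact: admh|exact: C0]|exact: fh].
Qed.

End Genericity.

Unset Implicit Arguments.

Theorem proposition4p1 (R : realType) (U : set 'rV[R]_6)
    (Uopen : open U) (Une : U !=set0) :
  (* (i) *)
  generically (pr13 @` U) (admissible (pr13 @` U))
    (fun f => ~ conformally_cotton_flat U (gD f)
              /\ ~ conformally_einstein U (gD f))
  /\
  forall f : 'rV[R]_2 -> R, admissible (pr13 @` U) f ->
    [/\ (* (ii) *)
        forall p, U p -> [/\ bach (gD f) p = 0,
                             schouten_sq (gD f) p = 0
                           & mu_tensor (gD f) p = 0],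
        (* (iii) *)
        forall p, U p ->
          [/\ obs_lapl_bach (gD f) p = 0,
              obs_weyl_bach (gD f) p = 0,
              obs_tr_bach (gD f) p = 0,
              obs_schouten_dcotton (gD f) p = 0
            & [/\ obs_cotton_cotton1 (gD f) p = 0,
                  obs_cotton_cotton2 (gD f) p = 0,
                  obs_cotton_dtr (gD f) p = 0,
                  obs_weyl_schouten_sq (gD f) p = 0
                & obstruction (gD f) p = 0]]
      & (* (iv) *)
        ambient_metric U (gD f)
          (fun p rho => gD f p + (2 * rho) *: schouten (gD f) p)].
Proof.
split; first exact: generically_not_conformally_flat.
move=> f adm; have UU := @subset_refl _ U.
(* The identities for g_D are proved in the model with a potential, here specialised to phi = 0 and
   D = U. *)
have s0 := @smooth_cst0 R 6 U.
have B0 p (Up : U p) := bach_gD Uopen Uopen UU adm s0 Up.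
have P20 p (Up : U p) := schouten_sq_gD Uopen Uopen UU adm s0 Up.
have T1 p (Up : U p) := obs_lapl_bach_gD Uopen Uopen UU adm s0 Up.
have T2 p (Up : U p) := obs_weyl_bach_gD Uopen Uopen UU adm s0 Up.
have T3 p (Up : U p) := obs_tr_bach_gD Uopen Uopen UU adm s0 Up.
have T4 p (Up : U p) := obs_schouten_dcotton_gD Uopen Uopen UU adm s0 Up.
have T5 p (Up : U p) := obs_cotton_cotton1_gD Uopen Uopen UU adm s0 Up.
have T6 p (Up : U p) := obs_cotton_cotton2_gD Uopen Uopen UU adm s0 Up.
have T7 p (Up : U p) := obs_cotton_dtr_gD Uopen Uopen UU adm s0 Up.
have T8 p (Up : U p) := obs_weyl_schouten_sq_gD Uopen Uopen UU adm s0 Up.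
split=> [p Up|p Up|]; last exact: ambient_metric_gD.
- by split; rewrite ?B0 ?P20 // /mu_tensor B0 // P20 // scaler0 addr0.
- split; [exact: T1|exact: T2|exact: T3|exact: T4|].
  split; [exact: T5|exact: T6|exact: T7|exact: T8|].
  rewrite /obstruction T1 // T2 // T3 // T4 // T5 // T6 // T7 // T8 //.
  by rewrite !scaler0 !subr0 !addr0.
Qed.
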